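(* Let $X$ be a diffeological space, let $V$ be a diffeological vector space, and let $\mathrm{GL}(V)$ denote the space of all linear isomorphisms of diffeological vector spaces $V\to V$. Let $\varrho:\mathrm{GL}(V)\hookrightarrow\mathrm{Diff}(V)$ be the linear action of $\mathrm{GL}(V)$ on $V$. Then diffeological fiber bundles with gauge group $\mathrm{GL}(V)$ and typical fiber $V$ on $X$ are the same as diffeological vector bundles of typical fiber $V$ on $X$. Also, there exists a bijective correspondence between $\check H^1(X,\mathrm{GL}(V))$ and $\mathrm{Bund}_V(X,\mathrm{GL}(V))\cong\mathrm{Bund}_{Vect}(X,V)$, where $\mathrm{Bund}_{Vect}(X,V)$ is the set of isomorphism classes of diffeological vector bundles of fiber type $V$ on $X$.
   Context: Diffeology. A domain is an open subset of some $\mathbb{R}^n$; a diffeology on a set $X$ is a set of parametrizations (maps from domains to $X$), called plots, whose images cover $X$, closed under precomposition with smooth maps between domains and under suprema of compatible families (families of plots on $n$-domains agreeing on overlaps). Smooth maps are those sending plots to plots by composition. A covering generating family of $X$ is a set $\mathcal{C}$ of plots whose images cover $X$ and such that every plot is the supremum of a compatible family of parametrizations $P\circ F$ with $P\in\mathcal{C}$, $F$ smooth between domains. A morphism of plots $Q\xrightarrow{F}P$ is a smooth map $F:\mathrm{dom}(Q)\to\mathrm{dom}(P)$ with $P\circ F=Q$. $\mathrm{Diff}(V)$ is the group of diffeomorphisms of $V$ with the standard diffeology: $P:U\to\mathrm{Diff}(V)$ is a plot iff $(r,t)\mapsto P(r)(t)$ and $(r,t)\mapsto P(r)^{-1}(t)$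 are smooth on $U\times V$; $\mathrm{GL}(V)\subseteq\mathrm{Diff}(V)$ has the subspace diffeology. Vector bundles. A diffeological vector space is a real vector space with a diffeology making addition and scalar multiplication smooth. A diffeological vector space over $X$ is a smooth map $\pi:E\to X$ with a real vector space structure on each fiber such that the addition $E\times_XE\to E$, the scalar multiplication $\mathbb{R}\times E\to E$ and the zero section $X\to E$ are smooth. A diffeological vector bundle of fiber type $V$ is a diffeological vector space $\pi:E\to X$ over $X$ such that for every plot $P$ in $X$ the pullback $P^*E=\{(u,e)\in\mathrm{dom}(P)\times E:P(u)=\pi(e)\}\to\mathrm{dom}(P)$ is locally trivial of fiber type $V$: $\mathrm{dom}(P)$ has an open cover $\{U_i\}$ such that over each $U_i$ there is a diffeomorphism to $U_i\times V$ commuting with the projections and restricting on each fiber to an isomorphism of diffeological vector spaces onto $V$. Isomorphisms over $X$ are diffeomorphisms over $X$ that are linear on fibers. In the next definitions $G=\mathrm{GL}(V)$ and $T=V$; we write $\varrho g(r)(t)$ for $\varrho(g(r))(t)$. Simplices. A $1$-simplex on $\mathcal{C}$ is a diagram $P_0\xleftarrow{F_1}Q\xrightarrow{F_0}P_1$ of morphisms of plots with $P_0,P_1\in\mathcal{C}$. A $2$-simplex on $\mathcal{C}$ consists of $P_0,P_1,P_2\in\mathcal{C}$, $1$-simplices $P_0\xleftarrow{F_{2,1}}Q_2\xrightarrow{F_{2,0}}P_1$, $P_0\xleftarrow{F_{1,2}}Q_1\xrightarrow{F_{1,0}}P_2$, $P_1\xleftarrow{F_{0,2}}Q_0\xrightarrow{F_{0,1}}P_2$,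 a plot $Q$ and morphisms $Q\xrightarrow{F_i}Q_i$ ($i=0,1,2$) with $F_{i,j}\circ F_i=F_{j,i}\circ F_j$. Bundles with gauge group. A diffeological fiber bundle with gauge group $G$ and typical fiber $T$ on $X$ is a smooth map $\pi:E\to X$ such that there is a covering generating family $\mathcal{C}$ of $X$ along with: (a) for every $P\in\mathcal{C}$ a smooth map $\psi_P:\mathrm{dom}(P)\times T\to E$ such that the square $\pi\circ\psi_P=P\circ\mathrm{Pr}_1$ is a pullback in the category of diffeological spaces; (b) for each $1$-simplex a smooth map $g_{P_0\xleftarrow{F_1}Q\xrightarrow{F_0}P_1}:\mathrm{dom}(Q)\to G$ with $\psi_{P_1}(F_0(r),t)=\psi_{P_0}\big(F_1(r),\varrho g_{P_0\xleftarrow{F_1}Q\xrightarrow{F_0}P_1}(r)(t)\big)$ for all $(r,t)\in\mathrm{dom}(Q)\times T$. A refinement of $\mathcal{C}=\{P_\alpha\}_{\alpha\in I}$ is a covering generating family $\mathcal{C}'=\{P'_\beta\}_{\beta\in J}$ with a map $\lambda:J\to I$ and morphisms $P'_\beta\xrightarrow{f_\beta}P_{\lambda(\beta)}$. An isomorphism between two such bundles $\pi:E\to X$, $\pi':E'\to X$ (with data $\mathcal{C},\psi,g$ and $\mathcal{C}',\psi',g'$) is a diffeomorphism $\Phi:E\to E'$ with $\pi'\circ\Phi=\pi$, together with a common refinement $\{R_\beta\}_{\beta\in J}$ of $\mathcal{C}$ and $\mathcal{C}'$ with refinement data $P_{\lambda(\beta)}\xleftarrow{f_\beta}R_\beta\xrightarrow{f'_\beta}P'_{\lambda'(\beta)}$,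 such that for each $\beta$ there is a smooth map $h_\beta:\mathrm{dom}(R_\beta)\to G$ with $\Phi\circ\psi_{P_{\lambda(\beta)}}(f_\beta(r),t)=\psi'_{P'_{\lambda'(\beta)}}(f'_\beta(r),\varrho h_\beta(r)(t))$ for all $(r,t)$. $\mathrm{Bund}_T(X,G)$ is the set of isomorphism classes. Čech cohomology. A diffeological Čech $1$-cocycle on $\mathcal{C}$ with values in $G$ assigns to each $1$-simplex on $\mathcal{C}$ a smooth map $g_{P_0\xleftarrow{F_1}Q\xrightarrow{F_0}P_1}:\mathrm{dom}(Q)\to G$ such that for every $2$-simplex on $\mathcal{C}$ and $r\in\mathrm{dom}(Q)$, $g_{P_0\xleftarrow{F_{2,1}}Q_2\xrightarrow{F_{2,0}}P_1}(F_2(r))\,g_{P_1\xleftarrow{F_{0,2}}Q_0\xrightarrow{F_{0,1}}P_2}(F_0(r))=g_{P_0\xleftarrow{F_{1,2}}Q_1\xrightarrow{F_{1,0}}P_2}(F_1(r))$. Cocycles $g,g'$ on $\mathcal{C}$ are equivalent if there are smooth maps $h_P:\mathrm{dom}(P)\to G$ ($P\in\mathcal{C}$) with $g'_{P_0\xleftarrow{F_1}Q\xrightarrow{F_0}P_1}(r)\,h_{P_1}(F_0(r))=h_{P_0}(F_1(r))\,g_{P_0\xleftarrow{F_1}Q\xrightarrow{F_0}P_1}(r)$ for every $1$-simplex and all $r$. $H^1(X,\mathcal{C},G)$ is the set of equivalence classes. A refinement induces a map $H^1(X,\mathcal{C},G)\to H^1(X,\mathcal{C}',G)$ by assigning to a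 $1$-simplex $P'_{\beta_0}\xleftarrow{F_1}Q\xrightarrow{F_0}P'_{\beta_1}$ the value of $g$ at $P_{\lambda(\beta_0)}\xleftarrow{f_{\beta_0}F_1}Q\xrightarrow{f_{\beta_1}F_0}P_{\lambda(\beta_1)}$; it does not depend on the particular refinement map. $\check H^1(X,G)=\varinjlim_{\mathcal{C}}H^1(X,\mathcal{C},G)$. *)

(* Defs.v *)
From HB Require Import structures.
From mathcomp Require Import all_boot all_order all_algebra.
From mathcomp Require Import boolp classical_sets functions reals topology normedtype landau derive.
Set Implicit Arguments. Unset Strict Implicit. Unset Printing Implicit Defensive.
Import Order.TTheory GRing.Theory Num.Theory numFieldNormedType.Exports.
Local Open Scope classical_set_scope.
Local Open Scope ring_scope.

Section SmoothOn.
Context {R : realType} {V W : normedModType R}.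

(* k-fold differentiability on an open set U: f is Frechet differentiable at every
   point of U, and so on for its directional derivatives.  Values of f outside
   U play no role. *)
Fixpoint ndiff (k : nat) (U : set V) (f : V -> W) : Prop :=
  if k is k'.+1 then
    (forall x, U x -> differentiable f x) /\
    (forall v, ndiff k' U (fun x => 'D_v f x))
  else True.

Definition smooth_on (U : set V) (f : V -> W) : Prop := forall k, ndiff k U f.

End SmoothOn.

Section Calculus.
Context {R : realType}.

Lemma near_eq_differentiable {V W : normedModType R} (f g : V -> W) x :
  (\near x, f x = g x) -> differentiable f x -> differentiable g x.
Proof.
move=> fg df; have fgx : f x = g x := nbhs_singleton fg.
have gE : g \o shift x = cst (g x) + 'd f x +o_ 0 id.
  apply/eqaddoP => e e0.
  have /eqaddoP/(_ e e0) := diff_locally df.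
  have := fg; rewrite (near_shift 0 x) => fg1.
  apply: filterS2 fg1 => y.
  by rewrite /= subr0 !fctE /= -fgx => ->.
have dgE : 'd g x = 'd f x :> (V -> W).
  by apply: diff_unique => //; exact: diff_continuous.
by apply/diff_locallyP; rewrite dgE; split => //; exact: diff_continuous.
Qed.

Lemma ndiff_local {V W : normedModType R} k (U : set V) (f : V -> W) :
  (forall x, U x -> exists (A : set V) (g : V -> W),
     [/\ open A, A x, ndiff k A g & forall y, A y -> f y = g y]) ->
  ndiff k U f.
Proof.
elim: k f => [//|k IH] f H; split.
  move=> x /H [A [g [oA Ax dg fg]]].
  apply: near_eq_differentiable (dg.1 x Ax).
  by apply: filterS (open_nbhs_nbhs (conj oA Ax)) => y /fg ->.
move=> v; apply: IH => x /H [A [g [oA Ax dg fg]]].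
exists A, (fun x => 'D_v g x); split => //; first exact: dg.2.
move=> y Ay; apply: near_eq_derive.
by apply: filterS (open_nbhs_nbhs (conj oA Ay)) => z /fg ->.
Qed.

Lemma ndiff_sub {V W : normedModType R} k (U U' : set V) (f : V -> W) :
  U' `<=` U -> ndiff k U f -> ndiff k U' f.
Proof.
move=> UU'; elim: k f => [//|k IH] f /= [df Df]; split.
  by move=> x /UU' /df.
by move=> v; apply: IH.
Qed.

Lemma ndiff_ext {V W : normedModType R} k (U : set V) (f g : V -> W) :
  open U -> (forall x, U x -> f x = g x) -> ndiff k U f -> ndiff k U g.
Proof.
move=> oU fg df; apply: ndiff_local => x Ux; exists U, f; split => // y Uy.
by rewrite fg.
Qed.

Lemma ndiffW {V W : normedModType R} k (U : set V) (f : V -> W) :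
  ndiff k.+1 U f -> ndiff k U f.
Proof.
elim: k f => [//|k IH] f [df Df]; split=> [|v]; first exact: df.
exact: (IH _ (Df v)).
Qed.

Lemma ndiff_cst {V W : normedModType R} k (U : set V) (c : W) :
  ndiff k U (fun=> c).
Proof.
elim: k c => [//|k IH] c; split; first by move=> x _; apply: differentiable_cst.
move=> v; have -> : (fun x => 'D_v (fun=> c) x) = (fun=> 0 : W).
  by apply/funext => x; exact: derive_cst.
exact: IH.
Qed.

Lemma ndiff_lin {V W : normedModType R} k (U : set V) (f : {linear V -> W}) :
  continuous f -> ndiff k U f.
Proof.
move=> cf; case: k => [//|k]; split.
  by move=> x _; apply: linear_differentiable.
move=> v; have -> : (fun x => 'D_v f x) = (fun=> f v).
  apply/funext => x; rewrite deriveE; last exact: linear_differentiable.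
  by rewrite diff_lin.
exact: ndiff_cst.
Qed.

Lemma ndiffD {V W : normedModType R} k (U : set V) (f g : V -> W) : open U ->
  ndiff k U f -> ndiff k U g -> ndiff k U (fun x => f x + g x).
Proof.
move=> oU; elim: k f g => [//|k IH] f g [df Df] [dg Dg]; split.
  by move=> x Ux; apply: differentiableD; [apply: df|apply: dg].
move=> v; apply: ndiff_ext (IH _ _ (Df v) (Dg v)) => // x Ux.
by rewrite -deriveD //; apply: diff_derivable; [apply: df|apply: dg].
Qed.

Lemma ndiff_sum {V W : normedModType R} k (U : set V) n (f : 'I_n -> V -> W) :
  open U ->
  (forall i, ndiff k U (f i)) -> ndiff k U (fun x => \sum_(i < n) f i x).
Proof.
move=> oU; elim: n f => [|n IH] f H.
  by under eq_fun do rewrite big_ord0; exact: ndiff_cst.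
under eq_fun do rewrite big_ord_recr /=.
by apply: ndiffD => //; apply: IH => i.
Qed.

Definition scale_fun (W : normedModType R) (a : R^o) (w : W) : W := a *: w.

Lemma scale_fun_is_bilinear (W : normedModType R) :
  bilinear_for
    (GRing.Scale.Law.clone _ _ *:%R _) (GRing.Scale.Law.clone _ _ *:%R _)
    (@scale_fun W).
Proof.
rewrite /scale_fun; split=> [u'|u] a x y /=; first by rewrite scalerDl scalerA.
by rewrite scalerDr !scalerA mulrC.
Qed.
HB.instance Definition _ (W : normedModType R) :=
  bilinear_isBilinear.Build R R^o W W _ _ (@scale_fun W)
  (scale_fun_is_bilinear W).

Lemma is_diff_scale {W : normedModType R} (p : R^o * W) :
  is_diff p (fun q : R^o * W => q.1 *: q.2)
    (fun q => p.1 *: q.2 + q.1 *: p.2).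
Proof.
have c : continuous (fun q : R^o * W => (q.1 : R) *: q.2).
  by move=> q; apply: scale_continuous.
apply: DiffDef; first exact: (@differentiable_bilin _ _ _ _ (@scale_fun W)).
exact: (@diff_bilin _ _ _ _ (@scale_fun W)).
Qed.

Lemma differentiable_scale {V W : normedModType R} (a : V -> R^o) (f : V -> W) x :
  differentiable a x -> differentiable f x ->
  differentiable (fun x => a x *: f x) x.
Proof.
move=> da df; have h := is_diff_scale (a x, f x).
exact: (@differentiable_comp _ _ _ _ (fun x => (a x, f x))
  (fun q : R^o * W => q.1 *: q.2) x (differentiable_pair da df) ex_diff).
Qed.

Lemma derive_scale {V W : normedModType R} (a : V -> R^o) (f : V -> W) x v :
  differentiable a x -> differentiable f x ->
  'D_v (fun x => a x *: f x) x = a x *: 'D_v f x + 'D_v a x *: f x.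
Proof.
move=> da df; rewrite deriveE; last exact: differentiable_scale.
have h := is_diff_scale (a x, f x).
rewrite (@diff_comp _ _ _ _ (fun x => (a x, f x))
  (fun q : R^o * W => q.1 *: q.2)) //=; last exact: differentiable_pair.
by rewrite diff_val diff_pair //= -!deriveE.
Qed.

Lemma ndiff_scale {V W : normedModType R} k (U : set V) (a : V -> R^o)
  (f : V -> W) : open U ->
  ndiff k U a -> ndiff k U f -> ndiff k U (fun x => a x *: f x).
Proof.
move=> oU; elim: k a f => [//|k IH] a f Ha Hf; split.
  by move=> x Ux; apply: differentiable_scale; [apply: Ha.1|apply: Hf.1].
move=> v; have Dv : ndiff k U (fun x => a x *: 'D_v f x + 'D_v a x *: f x).
  apply: ndiffD => //; apply: IH; [exact: ndiffW|exact: Hf.2|exact: Ha.2|].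
  exact: ndiffW.
apply: ndiff_ext Dv => // x Ux.
by rewrite derive_scale //; [apply: Ha.1|apply: Hf.1].
Qed.

Lemma ndiff_comp_lin {V V' W : normedModType R} k (U : set V) (f : V -> V')
  (L : {linear V' -> W}) : open U -> continuous L ->
  ndiff k U f -> ndiff k U (fun x => L (f x)).
Proof.
move=> oU cL; elim: k f => [//|k IH] f Hf; split.
  move=> x Ux; apply: (@differentiable_comp _ _ _ _ f L); first exact: Hf.1.
  exact: linear_differentiable.
move=> v; apply: ndiff_ext (IH _ (Hf.2 v)) => // x Ux.
have df : differentiable f x by exact: Hf.1.
have dL : differentiable L (f x) by exact: linear_differentiable.
have dLf : differentiable (fun x => L (f x)) x.
  exact: (@differentiable_comp _ _ _ _ f L).
rewrite [RHS]deriveE // (@diff_comp _ _ _ _ f L) //= diff_lin //.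
by rewrite deriveE.
Qed.

Lemma ndiff_coord {V : normedModType R} k (U : set V) m (f : V -> 'rV[R]_m) i :
  open U -> ndiff k U f -> ndiff k U (fun x => f x 0 i : R^o).
Proof.
move=> oU; elim: k f => [//|k IH] f Hf; split.
  move=> x Ux; apply: (@differentiable_comp _ _ _ _ f
    (fun N : 'rV[R]_m => N 0 i : R^o)); first exact: Hf.1.
  exact: differentiable_coord.
move=> v; apply: ndiff_ext (IH _ (Hf.2 v)) => // x Ux.
rewrite derive_mx ?mxE //; exact: diff_derivable (Hf.1 x Ux).
Qed.

Lemma ndiff_comp {n m} {W : normedModType R} k (U : set 'rV[R]_n)
  (U' : set 'rV[R]_m) (f : 'rV[R]_n -> 'rV[R]_m) (g : 'rV[R]_m -> W) :
  open U -> (forall x, U x -> U' (f x)) ->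
  ndiff k U f -> ndiff k U' g -> ndiff k U (g \o f).
Proof.
move=> oU UU'; elim: k g => [//|k IH] g Hf Hg; split.
  move=> x Ux; apply: differentiable_comp; first exact: Hf.1.
  by apply: Hg.1; apply: UU'.
move=> v.
have Hs : ndiff k U (fun x => \sum_(i < m)
    ('D_v f x) 0 i *: ('D_(delta_mx 0 i) g \o f) x).
  apply: ndiff_sum => // i; apply: ndiff_scale => //.
    by apply: ndiff_coord => //; apply: Hf.2.
  by apply: IH; [exact: ndiffW|exact: Hg.2].
apply: ndiff_ext Hs => // x Ux.
have df := Hf.1 x Ux; have dg := Hg.1 _ (UU' _ Ux).
rewrite [RHS]deriveE; last exact: differentiable_comp.
rewrite diff_comp //= [X in _ = _ X](row_sum_delta ('d f x v)) linear_sum.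
by apply: eq_bigr => i _; rewrite linearZ /= !deriveE.
Qed.

End Calculus.
Section Domains.
Context {R : realType}.

Record domain (n : nat) := Domain {
  dom_set :> 'rV[R]_n -> Prop;
  dom_open : open (dom_set : set 'rV[R]_n) }.

Arguments dom_open {n} d.

Definition dom_pt n (U : domain n) : Type := {x : 'rV[R]_n | U x}.
Coercion dom_pt : domain >-> Sortclass.

(* Functions on a domain U live on the subtype; smoothness is that of an
   arbitrary (junk-valued outside U) extension to R^n. *)
Definition smooth_map n (U : domain n) (W : normedModType R) (F : U -> W) :=
  exists2 f : 'rV[R]_n -> W, smooth_on U f & forall x : U, F x = f (sval x).

Definition smooth_dom n m (U : domain n) (U' : domain m) (F : U -> U') :=
  smooth_map (fun x => sval (F x)).

Definition full_domain n : domain n := Domain (@openT 'rV[R]_n).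

(* A set of parametrizations of X by n-domains. *)
Definition nparams (X : Type) (n : nat) :=
  forall U : domain n, (U -> X) -> Prop.

Definition compatible X n (A : nparams X n) :=
  forall (U U' : domain n) (p : U -> X) (p' : U' -> X), A U p -> A U' p' ->
  forall (x : U) (x' : U'), sval x = sval x' -> p x = p' x'.

Definition is_supremum X n (A : nparams X n) (U : domain n) (S : U -> X) :=
  [/\ compatible A,
      forall x, U x <-> exists (W : domain n) (p : W -> X), A W p /\ W x &
      forall (W : domain n) (p : W -> X), A W p ->
        forall (x : U) (y : W), sval x = sval y -> S x = p y].

Record diffeology (X : Type) := Diffeology {
  is_plot : forall n (U : domain n), (U -> X) -> Prop;
  plot_cover : forall x, exists n (U : domain n) (P : U -> X),
    is_plot P /\ exists r, P r = x;
  plot_comp : forall n m (U : domain n) (U' : domain m) (P : U' -> X)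
    (F : U -> U'), is_plot P -> smooth_dom F -> is_plot (P \o F);
  plot_sup : forall n (A : nparams X n) (U : domain n) (S : U -> X),
    (forall (W : domain n) (p : W -> X), A W p -> is_plot p) ->
    is_supremum A S -> is_plot S }.

Record diffSpace := DiffSpace {
  carrier :> Type;
  dfl : diffeology carrier }.

Lemma sval_inj T (P : T -> Prop) (x y : {z | P z}) : sval x = sval y -> x = y.
Proof.
by case: x y => [x Px] [y Py] /= exy; subst y; congr exist; exact: Prop_irrelevance.
Qed.

Lemma smooth_map_cst n (U : domain n) (W : normedModType R) (w : W) :
  smooth_map (fun _ : U => w).
Proof. by exists (fun=> w) => // k; exact: ndiff_cst. Qed.

Lemma smooth_dom_cst n m (U : domain n) (U' : domain m) (x : U') :
  smooth_dom (fun _ : U => x).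
Proof. exact: smooth_map_cst. Qed.

Lemma smooth_map_comp n m (U : domain n) (U' : domain m) (W : normedModType R)
  (P : U' -> W) (F : U -> U') :
  smooth_map P -> smooth_dom F -> smooth_map (P \o F).
Proof.
move=> [p sp pE] [f sf fE]; exists (p \o f); last first.
  by move=> x /=; rewrite pE fE.
move=> k; apply: (ndiff_comp (dom_open U) _ (sf k) (sp k)) => x Ux.
by rewrite -(fE (exist _ x Ux)); exact: svalP.
Qed.

Lemma smooth_map_sup n (W : normedModType R) (A : nparams W n) (U : domain n)
  (S : U -> W) :
  (forall (U' : domain n) (p : U' -> W), A U' p -> smooth_map p) ->
  is_supremum A S -> smooth_map S.
Proof.
move=> sA [_ AU SA].
pose s x := if pselect (U x) is left Ux then S (exist _ x Ux) else 0.
exists s; last first.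
  move=> x; rewrite /s; case: pselect => [Ux|]; last by case: x.
  by congr S; exact: sval_inj.
move=> k; apply: ndiff_local => x Ux.
have [U' [p [Ap U'x]]] := (AU x).1 Ux; have [q sq qE] := sA _ _ Ap.
exists U', q; split => //; first exact: dom_open.
move=> y U'y; rewrite /s; case: pselect => [Uy|[]]; last by apply/AU; exists U', p.
by rewrite (SA _ _ Ap _ (exist _ y U'y)) // qE.
Qed.

Lemma smooth_map_cover (W : normedModType R) (w : W) :
  exists n (U : domain n) (P : U -> W), smooth_map P /\ exists r, P r = w.
Proof.
exists 0%N, (full_domain 0), (fun=> w); split; first exact: smooth_map_cst.
by exists (exist _ 0 I).
Qed.

Definition normed_space (W : normedModType R) : diffSpace :=
  DiffSpace (Diffeology (@smooth_map_cover W)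
    (fun n m (U : domain n) (U' : domain m) => @smooth_map_comp n m U U' W)
    (fun n => @smooth_map_sup n W)).

Definition real_space : diffSpace := normed_space R^o.

Definition smooth (X Y : diffSpace) (f : X -> Y) :=
  forall n (U : domain n) (P : U -> X),
  is_plot (dfl X) P -> is_plot (dfl Y) (f \o P).

Section PlotLemmas.
Variable X : diffSpace.

Lemma plot_cst n (U : domain n) (x : X) : is_plot (dfl X) (fun _ : U => x).
Proof.
have [m [U' [P [pP [r <-]]]]] := plot_cover (dfl X) x.
exact: (plot_comp pP (@smooth_dom_cst _ _ U U' r)).
Qed.

Lemma plot_local n (U : domain n) (P : U -> X) :
  (forall x : U, exists (W : domain n) (WU : forall y, W y -> U y),
     W (sval x) /\
     is_plot (dfl X) (fun y : W => P (exist _ (sval y) (WU _ (svalP y))))) ->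
  is_plot (dfl X) P.
Proof.
move=> H; pose A (W : domain n) (p : W -> X) := is_plot (dfl X) p /\
  exists WU : forall y, W y -> U y,
    p = fun y : W => P (exist _ (sval y) (WU _ (svalP y))).
apply: (@plot_sup _ _ _ A) => [W p []//|]; split.
- move=> W W' p p' [_ [WU ->]] [_ [WU' ->]] x x' xx'.
  by congr P; exact: sval_inj.
- move=> x; split=> [Ux|[W [p [[_ [WU _]]]]]]; last exact: WU.
  have [W [WU [Wx pP]]] := H (exist _ x Ux).
  exists W, (fun y : W => P (exist _ (sval y) (WU _ (svalP y)))).
  by split; [split; [|exists WU]|].
- by move=> W p [_ [WU ->]] x y xy; congr P; exact: sval_inj.
Qed.

End PlotLemmas.

Lemma is_supremum_map X Y (f : X -> Y) n (A : nparams X n) (U : domain n)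
  (S : U -> X) : is_supremum A S ->
  is_supremum (fun W q => exists2 p : W -> X, A W p & q = f \o p) (f \o S).
Proof.
move=> [cA AU AS]; split.
- move=> W W' _ _ [p Ap ->] [p' Ap' ->] x x' xx' /=.
  by rewrite (cA _ _ _ _ Ap Ap' _ _ xx').
- move=> x; rewrite AU; split=> [[W [p [Ap Wx]]]|[W [q [[p Ap _] Wx]]]].
    by exists W, (f \o p); split => //; exists p.
  by exists W, p.
- by move=> W _ [p Ap ->] x y xy /=; rewrite (AS _ _ Ap _ _ xy).
Qed.

Section SubSpace.
Variables (X : diffSpace) (A : X -> Prop).

Definition sub_plot n (U : domain n) (P : U -> {x : X | A x}) :=
  is_plot (dfl X) (fun u => sval (P u)).

Lemma sub_plot_cover (x : {x : X | A x}) :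
  exists n (U : domain n) (P : U -> {x : X | A x}),
    sub_plot P /\ exists r, P r = x.
Proof.
exists 0%N, (full_domain 0), (fun=> x); split; first exact: plot_cst.
by exists (exist _ 0 I).
Qed.

Lemma sub_plot_comp n m (U : domain n) (U' : domain m)
  (P : U' -> {x : X | A x}) (F : U -> U') :
  sub_plot P -> smooth_dom F -> sub_plot (P \o F).
Proof. by move=> pP sF; exact: (plot_comp pP sF). Qed.

Lemma sub_plot_sup n (B : nparams {x : X | A x} n) (U : domain n)
  (S : U -> {x : X | A x}) :
  (forall (W : domain n) (p : W -> {x : X | A x}), B W p -> sub_plot p) ->
  is_supremum B S -> sub_plot S.
Proof.
move=> pB /(is_supremum_map (@sval _ _)); apply: plot_sup => W _ [p Bp ->].
exact: pB Bp.
Qed.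

Definition sub_space : diffSpace :=
  DiffSpace (Diffeology sub_plot_cover sub_plot_comp sub_plot_sup).

End SubSpace.

Definition dom_space n (U : domain n) : diffSpace :=
  @sub_space (normed_space 'rV[R]_n) U.

Section ProdSpace.
Variables X Y : diffSpace.

Definition prod_plot n (U : domain n) (P : U -> X * Y) :=
  is_plot (dfl X) (fst \o P) /\ is_plot (dfl Y) (snd \o P).

Lemma prod_plot_cover (z : X * Y) :
  exists n (U : domain n) (P : U -> X * Y), prod_plot P /\ exists r, P r = z.
Proof.
exists 0%N, (full_domain 0), (fun=> z); split; first by split; exact: plot_cst.
by exists (exist _ 0 I).
Qed.

Lemma prod_plot_comp n m (U : domain n) (U' : domain m) (P : U' -> X * Y)
  (F : U -> U') : prod_plot P -> smooth_dom F -> prod_plot (P \o F).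
Proof.
by move=> [p1 p2] sF; split; [exact: (plot_comp p1 sF)|exact: (plot_comp p2 sF)].
Qed.

Lemma prod_plot_sup n (B : nparams (X * Y) n) (U : domain n) (S : U -> X * Y) :
  (forall (W : domain n) (p : W -> X * Y), B W p -> prod_plot p) ->
  is_supremum B S -> prod_plot S.
Proof.
move=> pB sB; split.
  apply: plot_sup (is_supremum_map fst sB) => W _ [p Bp ->].
  exact: (pB _ _ Bp).1.
apply: plot_sup (is_supremum_map snd sB) => W _ [p Bp ->].
exact: (pB _ _ Bp).2.
Qed.

Definition prod_space : diffSpace :=
  DiffSpace (Diffeology prod_plot_cover prod_plot_comp prod_plot_sup).

End ProdSpace.

Record diffeo (X Y : diffSpace) := Diffeo {
  diffeo_fun :> X -> Y;
  diffeo_inv : Y -> X;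
  diffeo_smooth : smooth diffeo_fun;
  diffeo_inv_smooth : smooth diffeo_inv;
  diffeoK : cancel diffeo_fun diffeo_inv;
  diffeoVK : cancel diffeo_inv diffeo_fun }.

Lemma smooth_id X : @smooth X X id.
Proof. by []. Qed.

Lemma smooth_comp (X Y Z : diffSpace) (g : Y -> Z) (f : X -> Y) :
  smooth g -> smooth f -> @smooth X Z (g \o f).
Proof. by move=> sg sf n U P /sf /sg. Qed.

Definition diffeo_id X : diffeo X X :=
  Diffeo (@smooth_id X) (@smooth_id X) (frefl _) (frefl _).

Definition diffeo_comp X Y Z (g : diffeo Y Z) (f : diffeo X Y) : diffeo X Z :=
  Diffeo (smooth_comp (@diffeo_smooth _ _ g) (@diffeo_smooth _ _ f))
    (smooth_comp (@diffeo_inv_smooth _ _ f) (@diffeo_inv_smooth _ _ g))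
    (can_comp (@diffeoK _ _ g) (@diffeoK _ _ f))
    (can_comp (@diffeoVK _ _ f) (@diffeoVK _ _ g)).

Section DiffGroup.
Variable V : diffSpace.

Definition ev_smooth n (U : domain n) (f : U -> V -> V) :=
  @smooth (prod_space (dom_space U) V) V (fun rt => f rt.1 rt.2).

Definition diff_plot n (U : domain n) (P : U -> diffeo V V) :=
  ev_smooth (fun r => P r) /\ ev_smooth (fun r => diffeo_inv (P r)).

Lemma ev_smooth_cst n (U : domain n) (f : V -> V) :
  smooth f -> ev_smooth (fun _ : U => f).
Proof. by move=> sf m W P [_ p2]; exact: sf p2. Qed.

Lemma ev_smooth_comp n m (U : domain n) (U' : domain m) (f : U' -> V -> V)
  (F : U -> U') : ev_smooth f -> smooth_dom F -> ev_smooth (f \o F).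
Proof.
move=> sf sF k W P [p1 p2].
apply: (sf _ _ (fun w => (F (P w).1, (P w).2))); split => //=.
exact: (@smooth_map_comp _ _ W U _ (fun x => sval (F x)) (fst \o P)).
Qed.

Lemma ev_smooth_sup n (A : forall W : domain n, (W -> V -> V) -> Prop)
  (U : domain n) (f : U -> V -> V) :
  (forall (W : domain n) (p : W -> V -> V), A W p -> ev_smooth p) ->
  is_supremum A f -> ev_smooth f.
Proof.
move=> sA [_ AU Af] k W P [[a sa aE] p2]; apply: plot_local => w /=.
have [U' [p [Ap U'w]]] := (AU (sval (P w).1)).1 (svalP (P w).1).
pose B x := W x /\ U' (a x).
have oB : open (B : set _).
  rewrite openE => x [Wx U'x]; apply: filterI.
    exact: open_nbhs_nbhs (conj (dom_open W) Wx).
  have /differentiable_continuous ca := (sa 1%N).1 x Wx.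
  exact: ca (open_nbhs_nbhs (conj (dom_open U') U'x)).
pose W' := Domain oB; have W'W y : W' y -> W y by case.
exists W', W'W; split; first by split; [exact: svalP|rewrite -aE].
pose i (y : W') : W := exist _ (sval y) (W'W _ (svalP y)).
have si : smooth_dom i.
  exists id => // j; by apply: (@ndiff_lin _ _ _ _ _ idfun) => x; exact: cvg_id.
pose c (y : W') : U' := exist _ (a (sval y)) (svalP y).2.
have -> : (fun y : W' => f (P (i y)).1 (P (i y)).2) =
          (fun rt => p rt.1 rt.2) \o (fun y => (c y, (P (i y)).2)).
  apply/funext => y /=; rewrite (Af _ _ Ap _ (c y)) //.
  exact: aE (i y).
apply: (sA _ _ Ap); split; last exact: (plot_comp p2 si).
exists a => //= j.
by apply: ndiff_sub (sa j) => y [].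
Qed.

Lemma diff_plot_cover (f : diffeo V V) :
  exists n (U : domain n) (P : U -> diffeo V V), diff_plot P /\ exists r, P r = f.
Proof.
exists 0%N, (full_domain 0), (fun=> f); split; last by exists (exist _ 0 I).
by split; apply: ev_smooth_cst; [exact: diffeo_smooth|exact: diffeo_inv_smooth].
Qed.

Lemma diff_plot_comp n m (U : domain n) (U' : domain m) (P : U' -> diffeo V V)
  (F : U -> U') : diff_plot P -> smooth_dom F -> diff_plot (P \o F).
Proof.
move=> [p1 p2] sF; split; first exact: (ev_smooth_comp p1 sF).
exact: (ev_smooth_comp p2 sF).
Qed.

Lemma diff_plot_sup n (A : nparams (diffeo V V) n) (U : domain n)
  (S : U -> diffeo V V) :
  (forall (W : domain n) (p : W -> diffeo V V), A W p -> diff_plot p) ->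
  is_supremum A S -> diff_plot S.
Proof.
move=> sA SA; split.
  apply: ev_smooth_sup (is_supremum_map (@diffeo_fun V V) SA) => W _ [p Ap ->].
  exact: (sA _ _ Ap).1.
apply: ev_smooth_sup (is_supremum_map (@diffeo_inv V V) SA) => W _ [p Ap ->].
exact: (sA _ _ Ap).2.
Qed.

Definition Diff : diffSpace :=
  DiffSpace (Diffeology diff_plot_cover diff_plot_comp diff_plot_sup).

End DiffGroup.
End Domains.

Arguments domain R n : clear implicits.
Arguments nparams R X n : clear implicits.
Arguments diffeology R X : clear implicits.
Arguments diffSpace R : clear implicits.
Arguments full_domain {R} n.

Section VectorSpaces.
Context {R : realType}.

Record diffVS := DiffVS {
  vs_mod :> lmodType R;
  vs_dfl : diffeology R vs_mod;
  vs_space :> diffSpace R := DiffSpace vs_dfl;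
  vs_add_smooth :
    @smooth R (prod_space vs_space vs_space) vs_space (fun p => p.1 + p.2);
  vs_scale_smooth :
    @smooth R (prod_space real_space vs_space) vs_space (fun p => p.1 *: p.2) }.

Definition GL (V : diffVS) : diffSpace R :=
  @sub_space R (Diff V) (fun f => linear (f : V -> V)).

Definition gl_act (V : diffVS) (g : GL V) : Diff V := sval g.

Definition gl_mul (V : diffVS) (g g' : GL V) : GL V.
Proof.
exists (diffeo_comp (gl_act g) (gl_act g')) => a x y /=.
by rewrite (svalP g') (svalP g).
Defined.

Section Fibers.
Variables (E X : diffSpace R) (pi : E -> X).

Definition fiber (x : X) : Type := {e : E | pi e = x}.

Definition fiber_space (x : X) : diffSpace R := sub_space (fun e : E => pi e = x).

Definition fiber_product : diffSpace R :=
  @sub_space R (prod_space E E) (fun p => pi p.1 = pi p.2).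

Definition in_fiber x (e : E) (h : pi e = x) : fiber x := exist _ e h.

Section FiberOperations.
Variable L : forall x, GRing.Lmodule R (fiber x).

Definition fiber_lmod x : lmodType R := GRing.Lmodule.Pack (L x).

Definition fiber_add (p : fiber_product) : E :=
  sval ((in_fiber (svalP p) : fiber_lmod _) + in_fiber erefl).

Definition fiber_scale (p : R * E) : E :=
  sval (p.1 *: (in_fiber erefl : fiber_lmod (pi p.2))).

Definition fiber_zero (x : X) : E := sval (0 : fiber_lmod x).

End FiberOperations.

Record vs_over := VsOver {
  vo_smooth : smooth pi;
  vo_lmod : forall x, GRing.Lmodule R (fiber x);
  vo_add_smooth : @smooth R fiber_product E (fiber_add vo_lmod);
  vo_scale_smooth : @smooth R (prod_space real_space E) E (fiber_scale vo_lmod);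
  vo_zero_smooth : @smooth R X E (fiber_zero vo_lmod) }.

Definition vo_fiber (S : vs_over) (x : X) : lmodType R := fiber_lmod (vo_lmod S) x.

Definition pullback_space n (U : domain R n) (P : U -> X) : diffSpace R :=
  @sub_space R (prod_space (dom_space U) E) (fun q => P q.1 = pi q.2).

(* The part of P^*E lying over W; only used for W contained in U. *)
Definition pullback_over n (U : domain R n) (P : U -> X) (W : domain R n) :
  diffSpace R :=
  @sub_space R (pullback_space P) (fun q => W (sval (sval q).1)).

(* The fiber of P^*E at u is identified with the fiber of E at P u by
   (u, e) |-> e. *)
Definition trivial_over (V : diffVS) (S : vs_over) n (U : domain R n)
  (P : U -> X) (W : domain R n) :=
  exists Phi : diffeo (pullback_over P W) (prod_space (dom_space W) V),
    (forall q, sval (Phi q).1 = sval (sval (sval q)).1) /\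
    (forall u : U, W (sval u) ->
       exists2 phi : diffeo (fiber_space (P u)) V,
         linear (phi : vo_fiber S (P u) -> V) &
         forall q : pullback_over P W, (sval (sval q)).1 = u ->
         forall e : fiber_space (P u), sval e = (sval (sval q)).2 ->
           (Phi q).2 = phi e).

Record vect_str (V : diffVS) := VectStr {
  vb_vs :> vs_over;
  vb_trivial : forall n (U : domain R n) (P : U -> X), is_plot (dfl X) P ->
    exists C : domain R n -> Prop,
      [/\ forall W, C W -> forall x, W x -> U x,
          forall x, U x -> exists2 W, C W & W x &
          forall W, C W -> trivial_over V vb_vs P W] }.

End Fibers.

Definition is_vect_iso (V : diffVS) (X E E' : diffSpace R) (pi : E -> X)
  (pi' : E' -> X) (S : vect_str pi V) (S' : vect_str pi' V)
  (Phi : diffeo E E') :=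
  exists piPhi : forall e, pi' (Phi e) = pi e,
  forall x, linear ((fun e => in_fiber (etrans (piPhi (sval e)) (svalP e)))
                    : vo_fiber S x -> vo_fiber S' x).

End VectorSpaces.

Arguments diffVS R : clear implicits.

Section Plots.
Context {R : realType} {X : diffSpace R}.

Record plot := Plot {
  pl_dim : nat;
  pl_dom : domain R pl_dim;
  pl_map :> pl_dom -> X;
  pl_plot : is_plot (dfl X) pl_map }.

Record plot_hom (Q P : plot) := PlotHom {
  hom_fun :> pl_dom Q -> pl_dom P;
  hom_smooth : smooth_dom hom_fun;
  homE : forall r, P (hom_fun r) = Q r }.

Lemma hom_comp_smooth (P P' P'' : plot) (g : plot_hom P' P'')
  (f : plot_hom P P') : smooth_dom (g \o f).
Proof. exact: (smooth_map_comp (hom_smooth g) (hom_smooth f)). Qed.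

Lemma hom_compE (P P' P'' : plot) (g : plot_hom P' P'') (f : plot_hom P P') r :
  P'' ((g \o f) r) = P r.
Proof. by rewrite /= !homE. Qed.

Definition hom_comp (P P' P'' : plot) (g : plot_hom P' P'')
  (f : plot_hom P P') : plot_hom P P'' :=
  PlotHom (hom_comp_smooth g f) (hom_compE g f).

Record covering_family := CoveringFamily {
  cf_set :> plot -> Prop;
  cf_cover : forall x, exists2 P, cf_set P & exists r, P r = x;
  cf_generate : forall P : plot, exists A : nparams R X (pl_dim P),
    (forall (W : domain R (pl_dim P)) (p : W -> X), A W p ->
       exists P', cf_set P' /\
       exists2 F : W -> pl_dom P', smooth_dom F & p = P' \o F) /\
    is_supremum A P }.

Definition member (C : covering_family) : Type := {P : plot | C P}.
Definition mplot C (P : member C) : plot := sval P.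
Coercion mplot : member >-> plot.

(* C' refines C. *)
Record refinement (C C' : covering_family) := Refinement {
  ref_idx : member C' -> member C;
  ref_hom : forall P' : member C', plot_hom P' (ref_idx P') }.

Record simplex1 (C : covering_family) := Simplex1 {
  s1_P0 : member C;
  s1_P1 : member C;
  s1_Q : plot;
  s1_F1 : plot_hom s1_Q s1_P0;
  s1_F0 : plot_hom s1_Q s1_P1 }.

(* F21 : Q2 -> P0, F20 : Q2 -> P1, F12 : Q1 -> P0, and so on: Fij has source Qi
   and target Pk with {i, j, k} = {0, 1, 2}. *)
Record simplex2 (C : covering_family) := Simplex2 {
  s2_P0 : member C;
  s2_P1 : member C;
  s2_P2 : member C;
  s2_Q0 : plot;
  s2_Q1 : plot;
  s2_Q2 : plot;
  s2_F21 : plot_hom s2_Q2 s2_P0;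
  s2_F20 : plot_hom s2_Q2 s2_P1;
  s2_F12 : plot_hom s2_Q1 s2_P0;
  s2_F10 : plot_hom s2_Q1 s2_P2;
  s2_F02 : plot_hom s2_Q0 s2_P1;
  s2_F01 : plot_hom s2_Q0 s2_P2;
  s2_Q : plot;
  s2_F0 : plot_hom s2_Q s2_Q0;
  s2_F1 : plot_hom s2_Q s2_Q1;
  s2_F2 : plot_hom s2_Q s2_Q2;
  s2_E0 : forall r, s2_F21 (s2_F2 r) = s2_F12 (s2_F1 r);
  s2_E1 : forall r, s2_F20 (s2_F2 r) = s2_F02 (s2_F0 r);
  s2_E2 : forall r, s2_F10 (s2_F1 r) = s2_F01 (s2_F0 r) }.

Definition s2_face2 C (t : simplex2 C) := Simplex1 (s2_F21 t) (s2_F20 t).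
Definition s2_face1 C (t : simplex2 C) := Simplex1 (s2_F12 t) (s2_F10 t).
Definition s2_face0 C (t : simplex2 C) := Simplex1 (s2_F02 t) (s2_F01 t).

Definition ref_simplex1 C C' (f : refinement C C') (s : simplex1 C') :
    simplex1 C :=
  Simplex1 (hom_comp (ref_hom f (s1_P0 s)) (s1_F1 s))
           (hom_comp (ref_hom f (s1_P1 s)) (s1_F0 s)).

Section RefSimplex2.
Variables (C C' : covering_family) (f : refinement C C') (t : simplex2 C').
Let h0 := ref_hom f (s2_P0 t).
Let h1 := ref_hom f (s2_P1 t).
Let h2 := ref_hom f (s2_P2 t).

Definition ref_simplex2 : simplex2 C.
Proof.
refine (@Simplex2 C _ _ _ _ _ _
  (hom_comp h0 (s2_F21 t)) (hom_comp h1 (s2_F20 t))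
  (hom_comp h0 (s2_F12 t)) (hom_comp h2 (s2_F10 t))
  (hom_comp h1 (s2_F02 t)) (hom_comp h2 (s2_F01 t))
  _ (s2_F0 t) (s2_F1 t) (s2_F2 t) _ _ _) => r /=.
- by rewrite s2_E0.
- by rewrite s2_E1.
- by rewrite s2_E2.
Defined.

End RefSimplex2.

End Plots.

Arguments plot {R} X.
Arguments covering_family {R} X.

(* The set of classes of a relation, meant for equivalence relations. *)
Definition quot (T : Type) (r : T -> T -> Prop) : Type :=
  {c : T -> Prop | exists x, c = r x}.
Definition qclass (T : Type) (r : T -> T -> Prop) (x : T) : quot r :=
  exist _ (r x) (ex_intro _ x erefl).

Section Cech.
Context {R : realType} (X : diffSpace R) (V : diffVS R).

Record cocycle (C : covering_family X) := Cocycle {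
  coc_fun :> forall s : simplex1 C, pl_dom (s1_Q s) -> GL V;
  coc_smooth : forall s, @smooth R (dom_space _) (GL V) (@coc_fun s);
  cocE : forall (t : simplex2 C) (r : pl_dom (s2_Q t)),
    gl_mul (@coc_fun (s2_face2 t) (s2_F2 t r)) (@coc_fun (s2_face0 t) (s2_F0 t r))
    = @coc_fun (s2_face1 t) (s2_F1 t r) }.
Arguments coc_fun {C} g s r : rename.

Definition coc_equiv C (g g' : cocycle C) :=
  exists h : forall P : member C, pl_dom P -> GL V,
    (forall P, @smooth R (dom_space _) (GL V) (h P)) /\
    forall (s : simplex1 C) (r : pl_dom (s1_Q s)),
      gl_mul (g' s r) (h (s1_P1 s) (s1_F0 s r)) =
      gl_mul (h (s1_P0 s) (s1_F1 s r)) (g s r).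

Definition H1 (C : covering_family X) : Type := quot (@coc_equiv C).

Definition ref_cocycle C C' (f : refinement C C') (g : cocycle C) : cocycle C' :=
  @Cocycle C' (fun s => g (ref_simplex1 f s))
    (fun s => @coc_smooth C g (ref_simplex1 f s))
    (fun t => @cocE C g (ref_simplex2 f t)).

(* The class of the pullback of a chosen representative; it depends neither on
   this choice nor on the refinement map. *)
Definition H1_map C C' (f : refinement C C') (a : H1 C) : H1 C' :=
  qclass _ (ref_cocycle f (projT1 (cid (svalP a)))).

(* The direct limit over covering families directed by refinement: two classes
   are identified when they agree on a common refinement. *)
Definition cech_rel (a b : {C & H1 C}) :=
  exists (D : covering_family X) (f : refinement (projT1 a) D)
    (f' : refinement (projT1 b) D),
    H1_map f (projT2 a) = H1_map f' (projT2 b).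

Definition CechH1 : Type := quot cech_rel.

Definition cech_class C (g : cocycle C) : CechH1 :=
  qclass cech_rel (existT _ C (qclass (@coc_equiv C) g)).

End Cech.
Arguments coc_fun {R X V C} g s r : rename.

Section GaugeBundles.
Context {R : realType} (V : diffVS R).

Definition is_pullback (A B C D : diffSpace R) (p : A -> B) (q : A -> C)
    (f : B -> D) (g : C -> D) :=
  f \o p = g \o q /\
  forall (Z : diffSpace R) (b : Z -> B) (c : Z -> C), smooth b -> smooth c ->
    f \o b = g \o c ->
    exists! a : Z -> A, [/\ smooth a, p \o a = b & q \o a = c].

(* The covering family, the charts psi and the transition maps are data: they
   enter the notion of isomorphism below. *)
Record gauge_str (X E : diffSpace R) (pi : E -> X) := GaugeStr {
  gs_smooth : smooth pi;
  gs_fam : covering_family X;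
  gs_psi : forall P : member gs_fam, prod_space (dom_space (pl_dom P)) V -> E;
  gs_psi_smooth : forall P, @smooth R _ E (@gs_psi P);
  gs_pullback : forall P : member gs_fam,
    @is_pullback (prod_space (dom_space (pl_dom P)) V) (dom_space (pl_dom P)) E X
      fst (@gs_psi P) P pi;
  gs_trans : forall s : simplex1 gs_fam, pl_dom (s1_Q s) -> GL V;
  gs_trans_smooth : forall s, @smooth R (dom_space _) (GL V) (@gs_trans s);
  gs_transE : forall (s : simplex1 gs_fam) (r : pl_dom (s1_Q s)) (t : V),
    @gs_psi (s1_P1 s) (s1_F0 s r, t) =
    @gs_psi (s1_P0 s) (s1_F1 s r, gl_act (@gs_trans s r) t) }.
Arguments gs_psi {X E pi} B P : rename.
Arguments gs_trans {X E pi} B s r : rename.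

Definition is_gauge_iso (X E E' : diffSpace R) (pi : E -> X) (pi' : E' -> X)
  (B : gauge_str pi) (B' : gauge_str pi') (Phi : diffeo E E') :=
  (forall e, pi' (Phi e) = pi e) /\
  exists (D : covering_family X) (f : refinement (gs_fam B) D)
    (f' : refinement (gs_fam B') D),
  forall P : member D, exists h : pl_dom P -> GL V,
    @smooth R (dom_space _) (GL V) h /\
    forall (r : pl_dom P) (t : V),
      Phi (gs_psi B (ref_idx f P) (ref_hom f P r, t)) =
      gs_psi B' (ref_idx f' P) (ref_hom f' P r, gl_act (h r) t).

(* B and S sit on the same pi, and the charts of B are linear on fibers; this
   determines either structure from the other. *)
Definition fiberwise_linear (X E : diffSpace R) (pi : E -> X)
  (B : gauge_str pi) (S : vect_str pi V) :=
  forall (P : member (gs_fam B)) (r : pl_dom P),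
  exists piE : forall t : V, pi (gs_psi B P (r, t)) = P r,
    linear ((fun t => in_fiber (piE t)) : V -> vo_fiber (vb_vs S) (P r)).

Variable X : diffSpace R.

Record gauge_bundle := GaugeBundle {
  gb_tot : diffSpace R;
  gb_proj : gb_tot -> X;
  gb_str : gauge_str gb_proj }.

Definition gauge_iso (B B' : gauge_bundle) :=
  exists Phi, is_gauge_iso (gb_str B) (gb_str B') Phi.

Definition Bund : Type := quot gauge_iso.

Record vect_bundle := VectBundle {
  vb_tot : diffSpace R;
  vb_proj : vb_tot -> X;
  vb_str : vect_str vb_proj V }.

Definition vect_iso (S S' : vect_bundle) :=
  exists Phi, is_vect_iso (vb_str S) (vb_str S') Phi.

Definition BundVect : Type := quot vect_iso.

End GaugeBundles.
Arguments gs_psi {R V X E pi} B P : rename.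
Arguments gs_trans {R V X E pi} B s r : rename.

(* Main.v *)
Require Import Defs.
From HB Require Import structures.
From mathcomp Require Import all_boot all_order all_algebra.
From mathcomp Require Import boolp classical_sets reals topology normedtype.
From mathcomp Require Import derive.
Set Implicit Arguments. Unset Strict Implicit. Unset Printing Implicit Defensive.
Import GRing.Theory numFieldNormedType.Exports.
Local Open Scope classical_set_scope.
Local Open Scope ring_scope.

(** A gauge bundle and a vector bundle on the same projection are two ways of
recording one family of linear structures on the fibers for which there are
smooth linear charts locally on every plot of X ([locally_charted]).

The bridge is a reformulation of the pullback square: [psi] is cartesian over a
plot P exactly when each [psi (r, _)] is injective and every plot of E lying
over P lifts smoothly to V ([pullback_chart], [chart_pullback]).  Two charts
over one plot then differ by a smooth map to Diff(V), which takes values in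
GL(V) as soon as both charts are linear on fibers ([chart_change_gl]).

From a gauge bundle, a chart transports the vector space structure of V to the
fibers, and the result does not depend on the chart because the transition maps
lie in GL(V) ([gauge_lmod]); the fiberwise operations are smooth and the
pullbacks are locally trivial because this can be checked in charts
([charted_vect]).  From a vector bundle, local triviality says that the plots
carrying a linear chart form a covering generating family, and comparing charts
provides the transition maps ([vect_locally_charted], [charted_gauge]).  A
diffeomorphism over X is linear on fibers iff, on a common refinement, it is
given in charts by smooth maps to GL(V) ([gauge_vect_iso]).  Applied to the
identity this is the uniqueness of each structure given the other, and in
general it identifies the two sets of isomorphism classes.

The transition maps of a gauge bundle form a cocycle since charts are injective
on fibers.  Conversely a cocycle takes values that depend only on the points of
the two charts that are compared ([cocycle_pointwise]), so that it can be seen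
as a groupoid cocycle on points; it glues the products dom(P) x V into a bundle
with that cocycle ([cb_gauge]).  Finally, a space over X with charts is the
colimit of these charts ([glue_charts]), so that an equivalence of two cocycles
on a common refinement is the same thing as an isomorphism between bundles with
these cocycles ([coc_equiv_iso], [iso_coc_equiv]).  Both bijections of classes
then follow from a statement about quotients ([quot_bij]). *)

(** * Choice and quotients *)

Lemma dependent_choice_fun (A : Type) (B : A -> Type)
    (P : forall x, B x -> Prop) :
  (forall x, exists y, P x y) -> exists f : forall x, B x, forall x, P x (f x).
Proof.
by move=> H; exists (fun x => projT1 (cid (H x))) => x; apply: projT2 (cid _).
Qed.

Section Quotients.

Lemma qclassP (T : Type) (r : T -> T -> Prop) (c : quot r) :
  exists x, c = qclass r x.
Proof. by case: c => c [x cE]; exists x; exact: sval_inj. Qed.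

Lemma qclass_eq (T : Type) (r : T -> T -> Prop) x y :
  (forall x y, r x y -> r y x) -> (forall y x z, r x y -> r y z -> r x z) ->
  r x y -> qclass r x = qclass r y.
Proof.
move=> rC rT rxy; apply: sval_inj; apply/funext => z /=; apply/propext.
by split; [apply: (rT); exact: rC|exact: (rT)].
Qed.

Lemma qclass_eqr (T : Type) (r : T -> T -> Prop) x y :
  r y y -> qclass r x = qclass r y -> r x y.
Proof. by move=> ry /(congr1 sval) /= ->. Qed.

(** [r] is the pull-back of the equivalence relation [r'] along the
correspondence [m], hence itself an equivalence relation.  This is what makes
isomorphism of gauge bundles and equality of Cech classes equivalence relations,
without composing refinements. *)
Lemma quot_bij (T T' : Type) (r : T -> T -> Prop) (r' : T' -> T' -> Prop)
    (m : T -> T' -> Prop) :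
  (forall x, r' x x) -> (forall x y, r' x y -> r' y x) ->
  (forall y x z, r' x y -> r' y z -> r' x z) ->
  (forall x, exists x', m x x') -> (forall x', exists x, m x x') ->
  (forall x x' y y', m x x' -> m y y' -> (r x y <-> r' x' y')) ->
  exists2 Theta : quot r -> quot r', bijective Theta &
    forall x x', m x x' -> Theta (qclass r x) = qclass r' x'.
Proof.
move=> r'R r'C r'T ml mr mE.
have rR x : r x x by have [x' mx] := ml x; exact/(mE _ _ _ _ mx mx).
have rC x y : r x y -> r y x.
  have [x' mx] := ml x; have [y' my] := ml y.
  by move=> /(mE _ _ _ _ mx my)/r'C/(mE _ _ _ _ my mx).
have rT y x z : r x y -> r y z -> r x z.
  have [x' mx] := ml x; have [y' my] := ml y; have [z' mz] := ml z.
  move=> /(mE _ _ _ _ mx my) xy /(mE _ _ _ _ my mz) yz.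
  exact/(mE _ _ _ _ mx mz)/(r'T _ _ _ xy).
have /choice[Theta ThetaE] (c : quot r) : exists c' : quot r',
    exists x x', [/\ m x x', c = qclass r x & c' = qclass r' x'].
  have [x ->] := qclassP c; have [x' mx] := ml x.
  by exists (qclass r' x'), x, x'.
have /choice[Xi XiE] (c' : quot r') : exists c : quot r,
    exists x x', [/\ m x x', c = qclass r x & c' = qclass r' x'].
  have [x' ->] := qclassP c'; have [x mx] := mr x'.
  by exists (qclass r x), x, x'.
have ThetaP x x' : m x x' -> Theta (qclass r x) = qclass r' x'.
  move=> mx; have [y [y' [my xy ->]]] := ThetaE (qclass r x).
  apply: qclass_eq => //; apply/(mE _ _ _ _ my mx)/rC.
  exact: qclass_eqr xy.
exists Theta => //; exists Xi => [c|c'].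
  have [x [x' [mx -> ->]]] := ThetaE c.
  have [y [y' [my -> xy]]] := XiE (qclass r' x').
  apply: qclass_eq => //; apply/(mE _ _ _ _ my mx)/r'C.
  exact: qclass_eqr xy.
by have [x [x' [mx -> ->]]] := XiE c'; exact: ThetaP.
Qed.

End Quotients.

(** * Covering generating families *)

Section Restriction.
Context {R : realType}.

Lemma smooth_dom_id n (U : domain R n) : smooth_dom (@id U).
Proof.
exists id => // k; apply: (@ndiff_lin _ _ _ _ _ idfun) => x; exact: cvg_id.
Qed.

Definition restr n (U W : domain R n) (WU : forall y, W y -> U y) (w : W) : U :=
  exist _ (sval w) (WU _ (svalP w)).

Lemma smooth_dom_restr n (U W : domain R n) (WU : forall y, W y -> U y) :
  smooth_dom (restr WU).
Proof. exact: (smooth_dom_id W). Qed.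

Lemma smooth_dom_comp n m k (U : domain R n) (U' : domain R m)
    (U'' : domain R k) (G : U' -> U'') (F : U -> U') :
  smooth_dom G -> smooth_dom F -> smooth_dom (G \o F).
Proof. exact: (@smooth_map_comp _ _ _ U U' _ (fun x => sval (G x)) F). Qed.

(** The ambient extension of a smooth map of domains is differentiable, hence
continuous, at the points of its domain. *)
Lemma open_preimage n m (U : domain R n) (U' W' : domain R m) (F : U -> U') :
  smooth_dom F ->
  exists (W : domain R n) (WU : forall y, W y -> U y),
    (forall x : U, W (sval x) <-> W' (sval (F x))).
Proof.
move=> [f sf fE]; pose B (x : 'rV[R]_n) := U x /\ W' (f x).
have oB : open (B : set _).
  rewrite openE => x [Ux W'x]; apply: filterI.
    exact: open_nbhs_nbhs (conj (@dom_open _ _ U) Ux).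
  have /differentiable_continuous cf := (sf 1%N).1 x Ux.
  exact: cf (open_nbhs_nbhs (conj (@dom_open _ _ W') W'x)).
exists (Domain oB), (fun y => @proj1 _ _) => x /=; rewrite /B fE.
by split=> [[]//|W'x]; split => //; exact: svalP.
Qed.

Lemma plot_smooth (X : diffSpace R) n (U : domain R n) (P : U -> X) :
  is_plot (dfl X) P <-> @smooth R (dom_space U) X P.
Proof.
split=> [pP m W G sG|sP]; first exact: (plot_comp pP).
exact: (sP _ _ id (smooth_dom_id U)).
Qed.

End Restriction.

Section CoveringFamilies.
Context {R : realType} {X : diffSpace R}.

Definition restr_plot (P : plot X) (W : domain R (pl_dim P))
    (WU : forall y, W y -> pl_dom P y) : plot X :=
  Plot (plot_comp (pl_plot P) (smooth_dom_restr WU)).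

Definition point_plot (x : X) : plot X :=
  Plot (plot_cst (full_domain 0) x).

Definition point : full_domain (R := R) 0 := exist _ 0 I.

(** A plot is a supremum of plots that factor through the family, and the domains
of these plots cover its own. *)
Lemma cf_local (C : covering_family X) (P : plot X) (r : pl_dom P) :
  exists (W : domain R (pl_dim P)) (WU : forall y, W y -> pl_dom P y)
    (P' : member C) (f : plot_hom (restr_plot WU) P'), W (sval r).
Proof.
have [A [AC [_ AU AP]]] := cf_generate C P.
have [W [p [Ap Wr]]] := (AU _).1 (svalP r).
have WU y : W y -> pl_dom P y by move=> Wy; apply/AU; exists W, p.
have [P' [CP' [F sF pE]]] := AC _ _ Ap.
have FE (w : W) : P' (F w) = P (restr WU w).
  by rewrite (AP _ _ Ap _ w)// pE.
exists W, WU, (exist _ P' CP').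
by exists (@PlotHom _ _ (restr_plot WU) P' F sF FE).
Qed.

(** A set of plots to which every plot restricts near every point generates: a
plot is the supremum of its restrictions in the set. *)
Section LocalFamily.
Variable S : plot X -> Prop.
Hypothesis S_local : forall (P : plot X) (r : pl_dom P),
  exists (W : domain R (pl_dim P)) (WU : forall y, W y -> pl_dom P y),
    W (sval r) /\ S (restr_plot WU).

Lemma local_family_cover x : exists2 P, S P & exists r, P r = x.
Proof.
have [W [WU [W0 SW]]] := @S_local (point_plot x) point.
by exists (restr_plot WU) => //; exists (exist _ _ W0).
Qed.

Lemma local_family_generate (P : plot X) : exists A : nparams R X (pl_dim P),
  (forall (W : domain R (pl_dim P)) (p : W -> X), A W p ->
     exists P', S P' /\
     exists2 F : W -> pl_dom P', smooth_dom F & p = P' \o F) /\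
  is_supremum A P.
Proof.
exists (fun (W : domain R _) p => exists2 WU : forall y, W y -> pl_dom P y,
  S (restr_plot WU) & p = P \o restr WU); split.
  move=> W p [WU SW ->]; exists (restr_plot WU); split => //.
  by exists id => //; exact: smooth_dom_id.
split.
- move=> W W' p p' [WU _ ->] [WU' _ ->] x x' xx' /=.
  by congr (P _); exact: sval_inj.
- move=> x; split=> [Px|[W [p [[WU _ _] Wx]]]]; last exact: WU.
  have [W [WU [Wx SW]]] := S_local (exist _ x Px).
  by exists W, (P \o restr WU); split => //; exists WU.
- by move=> W p [WU _ ->] x y xy /=; congr (P _); exact: sval_inj.
Qed.

Definition local_family : covering_family X :=
  CoveringFamily local_family_cover local_family_generate.

End LocalFamily.

(** The plots that factor through both families can be reached from any plot by
two successive restrictions, one for each family. *)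
Lemma common_refinement (C C' : covering_family X) :
  exists (D : covering_family X) (f : refinement C D) (f' : refinement C' D),
    True.
Proof.
pose S (P : plot X) := (exists (P0 : member C) (_ : plot_hom P P0), True) /\
                       (exists (P0 : member C') (_ : plot_hom P P0), True).
have SL (P : plot X) (r : pl_dom P) :
    exists (W : domain R (pl_dim P)) (WU : forall y, W y -> pl_dom P y),
      W (sval r) /\ S (restr_plot WU).
  have [W [WU [P0 [f Wr]]]] := cf_local C r.
  have [W' [WU' [P0' [f' Wr']]]] :=
    @cf_local C' (restr_plot WU) (exist _ _ Wr).
  have WU2 y (W'y : W' y) := WU _ (WU' _ W'y).
  (* Restricting in one step or in two differs by the proof of inclusion. *)
  pose Q := @restr_plot P W' WU2.
  exists W', WU2; split => //; split.
    have sF := smooth_dom_comp (hom_smooth f) (smooth_dom_restr WU').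
    have fE w : P0 ((f \o restr WU') w) = Q w.
      by rewrite /= homE; congr (P _); exact: sval_inj.
    by exists P0, (@PlotHom _ _ Q P0 _ sF fE).
  have fE w : P0' (f' w) = Q w.
    by rewrite homE; congr (P _); exact: sval_inj.
  by exists P0', (@PlotHom _ _ Q P0' _ (hom_smooth f') fE).
pose D := local_family SL.
pose i (P : member D) : member C := projT1 (cid (svalP P).1).
pose i' (P : member D) : member C' := projT1 (cid (svalP P).2).
have h (P : member D) : plot_hom P (i P).
  exact: projT1 (cid (projT2 (cid (svalP P).1))).
have h' (P : member D) : plot_hom P (i' P).
  exact: projT1 (cid (projT2 (cid (svalP P).2))).
by exists D, (Refinement h), (Refinement h').
Qed.

Definition cst_hom (P : plot X) (r : pl_dom P) x (e : P r = x) :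
    plot_hom (point_plot x) P :=
  @PlotHom _ _ (point_plot x) P _ (@smooth_dom_cst _ _ _ (full_domain 0) _ r)
    (fun _ => e).

(** Two chart points over the same point of X, seen as a 1-simplex whose middle
plot is constant; evaluating at it reduces smooth data to data on points. *)
Definition point_simplex (C : covering_family X) (P P' : member C)
    (r : pl_dom P) (r' : pl_dom P') (e : P r = P' r') : simplex1 C :=
  Simplex1 (cst_hom e) (cst_hom (erefl (P' r'))).

End CoveringFamilies.
Arguments local_family {R X S} S_local.

(** * Smooth families of linear automorphisms *)

Section GeneralLinearGroup.
Context {R : realType} {V : diffVS R}.

Lemma gl_ext (g g' : GL V) : (forall t, gl_act g t = gl_act g' t) -> g = g'.
Proof.
case: g g' => [[f fi sf sfi fK fVK] lf] [[g gi sg sgi gK gVK] lg] /= fg.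
have {}fg : f = g by apply/funext.
subst g; have fgi : fi = gi.
  by apply/funext => t; rewrite -{1}(gVK t) fK.
by subst gi; apply: sval_inj => /=; congr Diffeo; exact: Prop_irrelevance.
Qed.

Lemma gl_smooth n (U : domain R n) (h : U -> GL V) :
  @smooth R (dom_space U) (GL V) h ->
  ev_smooth (fun r => gl_act (h r) : V -> V) /\
  ev_smooth (fun r => diffeo_inv (gl_act (h r)) : V -> V).
Proof. by move=> /plot_smooth. Qed.

Lemma gl_family n (U : domain R n) (a b : U -> V -> V) :
  ev_smooth a -> ev_smooth b -> (forall r, cancel (a r) (b r)) ->
  (forall r, cancel (b r) (a r)) -> (forall r, linear (a r)) ->
  exists h : U -> GL V, @smooth R (dom_space U) (GL V) h /\
    forall r t, gl_act (h r) t = a r t.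
Proof.
move=> sa sb ab ba la.
have s1 (c : U -> V -> V) r : ev_smooth c -> smooth (c r : V -> V).
  move=> sc m W P pP; apply: (sc m W (fun w => (r, P w))).
  by split => //; exact: plot_cst.
exists (fun r => exist _ (Diffeo (s1 _ r sa) (s1 _ r sb) (ab r) (ba r)) (la r)).
by split=> //; apply/plot_smooth.
Qed.

Lemma ev_smooth_mul n (U : domain R n) (a b : U -> V -> V) :
  ev_smooth a -> ev_smooth b -> ev_smooth (fun r t => a r (b r t)).
Proof.
move=> sa sb m W P [p1 p2].
apply: (sa m W (fun w => ((P w).1, b (P w).1 (P w).2))); split => //.
exact: (sb m W P).
Qed.

Lemma ev_smooth_plot n m (U : domain R n) (W : domain R m) (a : U -> V -> V)
    (F : W -> U) (v : W -> V) :
  ev_smooth a -> smooth_dom F -> is_plot (dfl V) v ->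
  is_plot (dfl V) (fun w => a (F w) (v w)).
Proof. by move=> sa sF pv; exact: (sa m W (fun w => (F w, v w))). Qed.

Definition gl_inv (g : GL V) : GL V.
Proof.
exists (Diffeo (diffeo_inv_smooth (gl_act g)) (diffeo_smooth (gl_act g))
  (diffeoVK (gl_act g)) (diffeoK (gl_act g))) => a x y /=.
apply: (can_inj (@diffeoK _ _ _ (gl_act g))).
by rewrite (svalP g) !diffeoVK.
Defined.

Lemma gl_id_linear : linear (diffeo_id V : V -> V).
Proof. by []. Qed.

Definition gl_one : GL V := exist _ (diffeo_id V) gl_id_linear.

Lemma gl_mul_smooth n (U : domain R n) (h h' : U -> GL V) :
  @smooth R (dom_space U) (GL V) h -> @smooth R (dom_space U) (GL V) h' ->
  @smooth R (dom_space U) (GL V) (fun r => gl_mul (h r) (h' r)).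
Proof.
move=> /gl_smooth[h1 h2] /gl_smooth[h'1 h'2]; apply/plot_smooth.
split; [exact: (ev_smooth_mul h1 h'1)|exact: (ev_smooth_mul h'2 h2)].
Qed.

Lemma gl_inv_smooth n (U : domain R n) (h : U -> GL V) :
  @smooth R (dom_space U) (GL V) h ->
  @smooth R (dom_space U) (GL V) (fun r => gl_inv (h r)).
Proof. by move=> /gl_smooth[h1 h2]; apply/plot_smooth; split. Qed.

Lemma gl_one_smooth n (U : domain R n) :
  @smooth R (dom_space U) (GL V) (fun _ => gl_one).
Proof. by apply/plot_smooth; exact: plot_cst. Qed.

Lemma gl_mul_inj (a b c : GL V) : gl_mul a b = gl_mul a c -> b = c.
Proof.
move=> abc; apply: gl_ext => t; apply: (can_inj (@diffeoK _ _ _ (gl_act a))).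
exact: (congr1 (fun h => gl_act h t) abc).
Qed.

Lemma gl_mul1 (a : GL V) : gl_mul a gl_one = a.
Proof. exact: gl_ext. Qed.

End GeneralLinearGroup.

(** * Linear frames of a fiber *)

Section LinearFrames.
Context {R : realType} {E X : diffSpace R} {proj : E -> X} {V : lmodType R}.
Variable L : forall x, GRing.Lmodule R (fiber proj x).

(** Linearity into the fiber over [x], stated for a map into the total space, so
that an equation between points of X acts on it by plain rewriting instead of a
transport between fibers. *)
Definition lin_frame (x : X) (u : V -> E) : Prop :=
  exists piE : forall t, proj (u t) = x,
    linear ((fun t => in_fiber (piE t)) : V -> fiber_lmod L x).

Lemma lin_frame_over x u t : lin_frame x u -> proj (u t) = x.
Proof. by case. Qed.

Lemma lin_frameP x u a t t' (h : proj (u t) = x) (h' : proj (u t') = x) :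
  lin_frame x u ->
  sval (a *: (in_fiber h : fiber_lmod L x) + in_fiber h') = u (a *: t + t').
Proof.
move=> [piE lu]; rewrite (Prop_irrelevance h (piE t)).
by rewrite (Prop_irrelevance h' (piE t')) -lu.
Qed.

Lemma lin_frame_comp x u (a : V -> V) :
  lin_frame x u -> linear a -> lin_frame x (u \o a).
Proof.
move=> [piE lu] la; exists (fun t => piE (a t)) => c t t' /=.
by rewrite -lu; apply: sval_inj => /=; rewrite la.
Qed.

Lemma lin_frame_change x u u' (a : V -> V) : injective u ->
  lin_frame x u -> lin_frame x u' -> (forall t, u' t = u (a t)) -> linear a.
Proof.
move=> iu lu lu' u'E c t t'; apply: iu; rewrite -u'E.
have h t0 := lin_frame_over t0 lu; have h' t0 := lin_frame_over t0 lu'.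
rewrite -(lin_frameP c (h _) (h _) lu) -(lin_frameP c (h' t) (h' t') lu').
have uE t0 : in_fiber (h' t0) = in_fiber (h (a t0)).
  by apply: sval_inj; exact: u'E.
by rewrite !uE.
Qed.

End LinearFrames.

(** * Charts as pullback squares *)

Section Charts.
Context {R : realType} {E X : diffSpace R} {proj : E -> X} {V : diffVS R}.

(** The pullback condition tested on points and on plots only: [chart_lift] is the
universal property for maps out of domains. *)
Record is_chart (P : plot X) (psi : prod_space (dom_space (pl_dom P)) V -> E) :
    Prop := IsChart {
  chart_smooth : smooth psi;
  chart_over : forall r t, proj (psi (r, t)) = P r;
  chart_inj : forall r, injective (fun t => psi (r, t));
  chart_lift : forall n (U : domain R n) (F : U -> pl_dom P) (p : U -> E),
    smooth_dom F -> is_plot (dfl E) p -> (forall u, proj (p u) = P (F u)) ->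
    exists2 v : U -> V, is_plot (dfl V) v & forall u, psi (F u, v u) = p u }.

Lemma chart_onto P psi (cpsi : @is_chart P psi) r e :
  proj e = P r -> exists t, psi (r, t) = e.
Proof.
move=> er.
have [v _ vE] := @chart_lift P psi cpsi _ (full_domain 0) (fun _ => r)
  (fun _ => e) (@smooth_dom_cst _ _ _ _ _ r) (plot_cst _ e) (fun _ => er).
by exists (v point).
Qed.

Lemma chart_plot P psi n (U : domain R n) (F : U -> pl_dom P) (v : U -> V) :
  @is_chart P psi -> smooth_dom F -> is_plot (dfl V) v ->
  is_plot (dfl E) (fun u => psi (F u, v u)).
Proof.
by move=> c sF pv; exact: (chart_smooth c (conj sF pv : is_plot
  (dfl (prod_space (dom_space (pl_dom P)) V)) (fun u => (F u, v u)))).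
Qed.

(** As charts are injective on fibers, any fiber coordinate of a plot is the one
that [chart_lift] provides, hence is smooth. *)
Lemma chart_lift_plot P psi n (U : domain R n) (F : U -> pl_dom P) (p : U -> E)
    (v : U -> V) : @is_chart P psi -> smooth_dom F -> is_plot (dfl E) p ->
  (forall u, psi (F u, v u) = p u) -> is_plot (dfl V) v.
Proof.
move=> c sF pp vE.
have [|w pw wE] := chart_lift c sF pp.
  by move=> u; rewrite -vE (chart_over c).
suff -> : v = w by [].
by apply/funext => u; apply: (chart_inj c (r := F u)); rewrite vE wE.
Qed.

(** Injectivity is the uniqueness part of the universal property for maps out of
a point. *)
Lemma pullback_chart (P : plot X) psi :
  @smooth R (prod_space (dom_space (pl_dom P)) V) E psi ->
  @is_pullback R (prod_space (dom_space (pl_dom P)) V) (dom_space (pl_dom P)) E X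
    fst psi P proj -> @is_chart P psi.
Proof.
move=> spsi [psiE univ]; split=> //.
- by move=> r t; rewrite -[RHS]/((P \o fst) (r, t)) psiE.
- move=> r t t' /= ee.
  have pP s v : proj (psi (s, v)) = P s.
    by rewrite -[RHS]/((P \o fst) (s, v)) psiE.
  have sc (Y : diffSpace R) (y : Y) :
    @smooth R (dom_space (full_domain 0)) Y (fun _ => y).
    by apply/plot_smooth; exact: plot_cst.
  (* Both (r, t) and (r, t') factor the same cone from a point. *)
  have [|a [_ aU]] := univ (dom_space (full_domain 0)) (fun=> r)
    (fun=> psi (r, t)) (sc (dom_space _) r) (sc _ _).
    by apply/funext => z /=; rewrite pP.
  have H t0 : psi (r, t0) = psi (r, t) -> a = (fun=> (r, t0)).
    by move=> e; apply: aU; split; [exact: (sc (prod_space (dom_space _) V))| |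
      apply/funext => z /=].
  have := H t erefl; rewrite (H t' (esym ee)) => /(congr1 (fun f => f point)).
  by case.
- move=> n U F p sF pp FE.
  have sF' : @smooth R (dom_space U) (dom_space (pl_dom P)) F.
    by apply/plot_smooth.
  have sp : @smooth R (dom_space U) E p by apply/plot_smooth.
  have FE' : P \o F = proj \o p by apply/funext => u /=; rewrite FE.
  have [a [[sa aF ap] _]] := univ (dom_space U) F p sF' sp FE'.
  have [_ pa] := (@plot_smooth _ (prod_space (dom_space (pl_dom P)) V) n U a).2 sa.
  exists (snd \o a) => // u.
  by rewrite -ap -aF /=; congr psi; case: (a u).
Qed.

(** Injectivity determines the second component of the factorization pointwise,
and its smoothness is tested on plots. *)
Lemma chart_pullback (P : plot X) psi : @is_chart P psi ->
  @is_pullback R (prod_space (dom_space (pl_dom P)) V) (dom_space (pl_dom P)) E X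
    fst psi P proj.
Proof.
move=> c; split; first by apply/funext => -[r t] /=; rewrite (chart_over c).
move=> Z b q sb sq bq.
have /choice[v vE] z : exists t, psi (b z, t) = q z.
  by apply: (chart_onto c); rewrite -[RHS]/((P \o b) z) bq.
exists (fun z => (b z, v z)); split; first split.
- move=> n U G pG; split; first exact: sb.
  apply: (@chart_lift_plot P psi _ U (b \o G) (q \o G)) => //.
  + exact: (sb _ _ _ pG).
  + exact: sq.
  + by move=> u /=.
- by apply/funext.
- by apply/funext.
- move=> a [_ ab aq]; apply/funext => z; rewrite -ab /=.
  have := congr1 (fun f => f z) aq => /=.
  rewrite -[in X in _ = X]vE -ab /= [in X in psi X](surjective_pairing (a z)).
  by move=> /(chart_inj c) <-; case: (a z).
Qed.

Lemma chart_pull (P Q : plot X) psi (f : plot_hom Q P) : @is_chart P psi ->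
  @is_chart Q (fun z => psi (f z.1, z.2)).
Proof.
move=> c; split.
- move=> n U G [G1 G2]; apply: (chart_plot (v := snd \o G) c) => //.
  exact: (smooth_dom_comp (hom_smooth f) G1).
- by move=> r t; rewrite (chart_over c) homE.
- by move=> r t t' /(chart_inj c).
- move=> n U F p sF pp pE.
  have [|v pv vE] := chart_lift c (smooth_dom_comp (hom_smooth f) sF) pp.
    by move=> u; rewrite pE -(homE f).
  by exists v.
Qed.

Lemma chart_twist (P : plot X) psi (h : pl_dom P -> GL V) :
  @smooth R (dom_space (pl_dom P)) (GL V) h -> @is_chart P psi ->
  @is_chart P (fun z => psi (z.1, gl_act (h z.1) z.2)).
Proof.
move=> /gl_smooth[sh shi] c; split.
- move=> n U G [G1 G2]; apply: (chart_plot (F := fst \o G)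
    (v := fun u => gl_act (h (G u).1) (G u).2) c) => //.
  exact: (ev_smooth_plot (F := fst \o G) (v := snd \o G) sh).
- by move=> r t; rewrite (chart_over c).
- by move=> r t t' /(chart_inj c)/(can_inj (diffeoK (gl_act (h r)))).
- move=> n U F p sF pp pE; have [v pv vE] := chart_lift c sF pp pE.
  exists (fun u => diffeo_inv (gl_act (h (F u))) (v u)).
    exact: (ev_smooth_plot shi).
  by move=> u /=; rewrite diffeoVK.
Qed.

Lemma chart_change (P : plot X) psi psi' : @is_chart P psi -> @is_chart P psi' ->
  exists2 a : pl_dom P -> V -> V, ev_smooth a &
    forall r t, psi' (r, t) = psi (r, a r t).
Proof.
move=> c c'.
have /choice[a aE] (z : pl_dom P * V) : exists t', psi (z.1, t') = psi' z.
  by apply: (chart_onto c); case: z => r t; rewrite (chart_over c').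
exists (fun r t => a (r, t)) => [n U G [G1 G2]|r t]; last by rewrite (aE (r, t)).
apply: (chart_lift_plot c (F := fst \o G) (p := psi' \o G)) => //.
  exact: (chart_smooth c').
by move=> u /=; rewrite -aE; case: (G u).
Qed.

(** The comparison of two charts over one plot is smooth in both directions; it
is linear because both charts are. *)
Lemma chart_change_gl (L : forall x, GRing.Lmodule R (fiber proj x))
    (P : plot X) psi psi' : @is_chart P psi -> @is_chart P psi' ->
  (forall r, lin_frame L (P r) (fun t : V => psi (r, t))) ->
  (forall r, lin_frame L (P r) (fun t : V => psi' (r, t))) ->
  exists h : pl_dom P -> GL V,
    @smooth R (dom_space (pl_dom P)) (GL V) h /\
    forall r t, psi' (r, t) = psi (r, gl_act (h r) t).
Proof.
move=> c c' l l'.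
have [a sa aE] := chart_change c c'; have [b sb bE] := chart_change c' c.
have [||r|h [sh hE]] := gl_family sa sb.
- by move=> r t; apply: (chart_inj c' (r := r)); rewrite /= -bE -aE.
- by move=> r t; apply: (chart_inj c (r := r)); rewrite /= -aE -bE.
- exact: (lin_frame_change (chart_inj c (r := r)) (l r) (l' r)).
- by exists h; split=> // r t; rewrite hE.
Qed.

End Charts.
Arguments is_chart {R E X} proj {V P} psi.

Lemma chart_push (R : realType) (X E E' : diffSpace R) (V : diffVS R)
    (pi : E -> X) (pi' : E' -> X) (Phi : diffeo E E') (P : plot X)
    (psi : prod_space (dom_space (pl_dom P)) V -> E) :
  (forall e, pi' (Phi e) = pi e) -> is_chart pi psi -> is_chart pi' (Phi \o psi).
Proof.
move=> piPhi c; split.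
- exact: (smooth_comp (diffeo_smooth Phi) (chart_smooth c)).
- by move=> r t; rewrite piPhi (chart_over c).
- by move=> r t t' /(can_inj (diffeoK Phi))/(chart_inj c).
- move=> n U F p sF pp pE.
  have [|v pv vE] := chart_lift c sF (diffeo_inv_smooth Phi pp).
    by move=> u /=; rewrite -piPhi diffeoVK pE.
  by exists v => // u /=; rewrite vE diffeoVK.
Qed.

(** * From locally charted fibers to both kinds of bundles *)

Section TransportModule.
Variables (R : pzRingType) (V : lmodType R) (T : Type).
Variables (f : T -> V) (g : V -> T).
Hypotheses (fK : cancel f g) (gK : cancel g f).

(** The index is the proof that [g] is inverted by [f], from which the instances
below recover the bijection. *)
Definition transport_type of cancel g f : Type := can_type fK.
Local Notation T' := (transport_type gK).

HB.instance Definition _ := Choice.copy T' (can_type fK).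

Let tzero : T' := g 0.
Let topp (x : T') : T' := g (- f x).
Let tadd (x y : T') : T' := g (f x + f y).
Let tscale a (x : T') : T' := g (a *: f x).

Let taddA : associative tadd.
Proof. by move=> x y z; rewrite /tadd !gK addrA. Qed.
Let taddC : commutative tadd.
Proof. by move=> x y; rewrite /tadd addrC. Qed.
Let tadd0 : left_id tzero tadd.
Proof. by move=> x; rewrite /tadd gK add0r fK. Qed.
Let taddN : left_inverse tzero topp tadd.
Proof. by move=> x; rewrite /tadd gK addNr. Qed.

HB.instance Definition _ := GRing.isZmodule.Build T' taddA taddC tadd0 taddN.

Let tscaleA a b (x : T') : tscale a (tscale b x) = tscale (a * b) x.
Proof. by rewrite /tscale gK scalerA. Qed.
Let tscale1 : left_id 1 tscale.
Proof. by move=> x; rewrite /tscale scale1r fK. Qed.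
Let tscaleDr : right_distributive tscale +%R.
Proof. by move=> a x y; rewrite /tscale /GRing.add /= /tadd !gK scalerDr. Qed.
Let tscaleDl (x : T') : {morph (fun a => tscale a x) : a b / a + b}.
Proof. by move=> a b; rewrite /tscale /GRing.add /= /tadd !gK scalerDl. Qed.

HB.instance Definition _ :=
  GRing.Zmodule_isLmodule.Build R T' tscaleA tscale1 tscaleDr tscaleDl.

Lemma transport_linear : linear (g : V -> T').
Proof.
move=> a x y; rewrite /GRing.add /= /tadd /GRing.scale /= /tscale.
by rewrite !gK.
Qed.

End TransportModule.

Lemma transport_lmod (R : pzRingType) (V : lmodType R) (T : Type) (f : T -> V)
    (g : V -> T) : cancel f g -> cancel g f ->
  exists L : GRing.Lmodule R T, linear (g : V -> GRing.Lmodule.Pack L).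
Proof.
move=> fK gK; pose T' : lmodType R := transport_type fK gK.
by exists (GRing.Lmodule.class T'); exact: (transport_linear fK gK).
Qed.

Section LocallyCharted.
Context {R : realType} {E X : diffSpace R} {proj : E -> X} {V : diffVS R}.
Variable L : forall x, GRing.Lmodule R (fiber proj x).

Definition linear_chart (P : plot X)
    (psi : prod_space (dom_space (pl_dom P)) V -> E) : Prop :=
  is_chart proj psi /\ forall r, lin_frame L (P r) (fun t : V => psi (r, t)).

(** The common content of both kinds of bundles on a given projection. *)
Definition locally_charted : Prop := forall (P : plot X) (r : pl_dom P),
  exists (W : domain R (pl_dim P)) (WU : forall y, W y -> pl_dom P y)
    (psi : prod_space (dom_space W) V -> E),
    W (sval r) /\ @linear_chart (restr_plot WU) psi.

Lemma linear_chart_pull (P Q : plot X) psi (f : plot_hom Q P) :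
  @linear_chart P psi -> @linear_chart Q (fun z => psi (f z.1, z.2)).
Proof.
move=> [c l]; split=> [|r]; first exact: chart_pull.
by rewrite -(homE f); exact: l.
Qed.

Lemma family_locally_charted (C : covering_family X) :
  (forall P : member C, exists psi, @linear_chart P psi) -> locally_charted.
Proof.
move=> HC P r; have [W [WU [P' [f Wr]]]] := cf_local C r.
have [psi lpsi] := HC P'.
exists W, WU, (fun z => psi (f z.1, z.2)); split => //.
exact: (linear_chart_pull f lpsi).
Qed.

Lemma fiber_addE x (u : V -> E) t t' (q : fiber_product proj) :
  lin_frame L x u -> (sval q).1 = u t -> (sval q).2 = u t' ->
  fiber_add L q = u (t + t').
Proof.
move=> lu; rewrite /fiber_add; move: (svalP q).
case: (sval q) => [e e'] h /= et et'; subst e e'.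
have ex := lin_frame_over t' lu; subst x.
by have := lin_frameP 1 h erefl lu; rewrite !scale1r.
Qed.

Lemma lin_frame0 x (u : V -> E) : lin_frame L x u -> fiber_zero L x = u 0.
Proof.
move=> [piE lu]; have := lu (-1) 0 0; rewrite scaler0 addr0 scaleN1r addNr.
by move=> /(congr1 sval).
Qed.

Lemma fiber_scaleE x (u : V -> E) a t e :
  lin_frame L x u -> e = u t -> fiber_scale L (a, e) = u (a *: t).
Proof.
move=> lu et; subst e; have ex := lin_frame_over t lu; subst x.
have h0 : proj (u 0) = proj (u t) by rewrite (lin_frame_over 0 lu).
have := lin_frameP a erefl h0 lu; rewrite addr0 => <-.
have -> : in_fiber h0 = 0 :> fiber_lmod L _.
  by apply: sval_inj => /=; rewrite -(lin_frame0 lu).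
by rewrite addr0.
Qed.

Hypothesis proj_smooth : smooth proj.
Hypothesis L_charted : locally_charted.

(** To see that [p], lying over the plot [b], is smooth, express it near each point
in a linear chart along [b], in which given plots over [b] have smooth
coordinates. *)
Lemma charted_plot n (U : domain R n) (b : U -> X) (p : U -> E) :
  is_plot (dfl X) b ->
  (forall (W : domain R n) (WU : forall y, W y -> U y)
     (psi : prod_space (dom_space W) V -> E),
     (forall (w : W), lin_frame L (b (restr WU w)) (fun t : V => psi (w, t))) ->
     (forall q : W -> E, is_plot (dfl E) q ->
        (forall w, proj (q w) = b (restr WU w)) ->
        exists2 v : W -> V, is_plot (dfl V) v & forall w, psi (w, v w) = q w) ->
     exists2 v : W -> V, is_plot (dfl V) v &
       forall w, psi (w, v w) = p (restr WU w)) ->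
  is_plot (dfl E) p.
Proof.
move=> pb H; apply: plot_local => u.
have [W [WU [psi [Wu [c l]]]]] := @L_charted (Plot pb) u.
exists W, WU; split => //.
have [|v pv vE] := H W WU psi l.
  by move=> q pq qE; apply: (chart_lift c (smooth_dom_id W) pq).
have -> : (fun y : W => p (exist _ (sval y) (WU _ (svalP y)))) =
          (fun w => psi (w, v w)) by apply/funext => w; rewrite vE.
exact: (chart_plot c (smooth_dom_id W) pv).
Qed.

Lemma charted_add_smooth : @smooth R (fiber_product proj) E (fiber_add L).
Proof.
move=> n U G [p1 p2]; apply: (charted_plot (proj_smooth p2)) => W WU psi l lift.
have [|v1 pv1 v1E] := lift _ (plot_comp p1 (smooth_dom_restr WU)).
  by move=> w; exact: (svalP (G (restr WU w))).
have [|v2 pv2 v2E] := lift _ (plot_comp p2 (smooth_dom_restr WU)).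
  by [].
exists (fun w => v1 w + v2 w).
  exact: (vs_add_smooth (conj pv1 pv2 : is_plot (dfl (prod_space V V))
    (fun w => (v1 w, v2 w)))).
by move=> w; rewrite /= (fiber_addE (l w) (esym (v1E w)) (esym (v2E w))).
Qed.

Lemma charted_scale_smooth :
  @smooth R (prod_space real_space E) E (fiber_scale L).
Proof.
move=> n U G [p1 p2]; apply: (charted_plot (proj_smooth p2)) => W WU psi l lift.
have [|v pv vE] := lift _ (plot_comp p2 (smooth_dom_restr WU)).
  by [].
exists (fun w => (G (restr WU w)).1 *: v w).
  exact: (vs_scale_smooth (conj (plot_comp p1 (smooth_dom_restr WU)) pv :
    is_plot (dfl (prod_space real_space V))
      (fun w => ((G (restr WU w)).1, v w)))).
move=> w; rewrite -(fiber_scaleE _ (l w) (esym (vE w))) /=.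
by case: (G _).
Qed.

Lemma charted_zero_smooth : @smooth R X E (fiber_zero L).
Proof.
move=> n U b pb; apply: (charted_plot pb) => W WU psi l _.
exists (fun _ => 0); first exact: plot_cst.
by move=> w; rewrite /= (lin_frame0 (l w)).
Qed.

Definition charted_vs_over : vs_over proj :=
  VsOver proj_smooth charted_add_smooth charted_scale_smooth
    charted_zero_smooth.

(** Near a point where a chart over [P] is defined, the trivialization sends
(u, e) to u and to the coordinate of e in the chart. *)
Lemma charted_trivial n (U : domain R n) (P : U -> X) (W : domain R n)
    (WU : forall y, W y -> U y) (pP : is_plot (dfl X) P)
    (psi : prod_space (dom_space W) V -> E) :
  @linear_chart (@restr_plot _ _ (Plot pP) W WU) psi ->
  trivial_over V charted_vs_over P W.
Proof.
set Q := restr_plot _ => -[c l].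
pose wq (q : pullback_over proj P W) : W :=
  exist _ (sval (sval (sval q)).1) (svalP q).
pose eq (q : pullback_over proj P W) : E := (sval (sval q)).2.
have wqE q : restr WU (wq q) = (sval (sval q)).1 by apply: sval_inj.
have projE q : proj (eq q) = P (restr WU (wq q)).
  by rewrite wqE /eq -(svalP (sval q)).
have /choice[k kE] q : exists t, psi (wq q, t) = eq q.
  exact: (chart_onto c (projE q)).
pose inv (z : prod_space (dom_space W) V) : pullback_over proj P W :=
  exist _ (exist _ (restr WU z.1, psi (z.1, z.2))
                   (esym (chart_over c z.1 z.2))) (svalP z.1).
have sPhi : @smooth R _ (prod_space (dom_space W) V) (fun q => (wq q, k q)).
  move=> m G p [p1 p2]; split => //.
  apply: (chart_lift_plot (P := Q) (F := wq \o p) (p := eq \o p) c p1 p2).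
  by move=> g; exact: kE.
have sinv : @smooth R (prod_space (dom_space W) V) _ inv.
  move=> m G p [p1 p2]; split => //.
  exact: (chart_plot (P := Q) (F := fst \o p) (v := snd \o p) c p1 p2).
have PhiK : cancel (fun q => (wq q, k q)) inv.
  move=> q; apply: sval_inj; apply: sval_inj => /=.
  by rewrite kE wqE /eq -surjective_pairing.
have invK : cancel inv (fun q => (wq q, k q)).
  move=> [w t]; have ww : wq (inv (w, t)) = w by apply: sval_inj.
  congr pair => //; apply: (chart_inj c (r := w)); have := kE (inv (w, t)).
  by rewrite ww.
exists (Diffeo sPhi sinv PhiK invK); split => // u Wu.
pose w : W := exist _ (sval u) Wu.
have wu : restr WU w = u by apply: sval_inj.
have /choice[k' k'E] (e : fiber_space proj (P u)) : exists t, psi (w, t) = sval e.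
  by apply: (chart_onto c); rewrite (svalP e) -[in LHS]wu.
have overu t : proj (psi (w, t)) = P u.
  by rewrite (chart_over c) -[in RHS]wu.
have sphi : @smooth R (fiber_space proj (P u)) V k'.
  move=> m G p pp.
  apply: (chart_lift_plot (P := Q) (F := fun _ => w) (p := fun g => sval (p g))
    c (smooth_dom_cst _ _)) => // g.
  exact: k'E.
have sphi' : @smooth R V (fiber_space proj (P u)) (fun t => in_fiber (overu t)).
  move=> m G p pp.
  exact: (chart_plot (P := Q) (F := fun _ => w) c (smooth_dom_cst _ _) pp).
have phiK : cancel k' (fun t => in_fiber (overu t)).
  by move=> e; apply: sval_inj => /=; rewrite k'E.
have phiVK : cancel (fun t => in_fiber (overu t)) k'.
  by move=> t; apply: (chart_inj c (r := w)); rewrite /= k'E.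
have lw : lin_frame L (P u) (fun t : V => psi (w, t)).
  by rewrite -[in X in lin_frame _ X]wu; exact: l.
exists (Diffeo sphi sphi' phiK phiVK) => /= [a e e'|q qu e eE].
  apply: (chart_inj c (r := w)); rewrite /= k'E.
  rewrite -(lin_frameP a (overu _) (overu _) lw).
  have inE e0 : in_fiber (overu (k' e0)) = e0 by exact: phiK.
  by rewrite !inE.
apply: (chart_inj c (r := w)); rewrite /= k'E eE -/(eq q) -kE.
by congr (psi (_, _)); apply: sval_inj => /=; rewrite qu.
Qed.

Lemma charted_vect : exists S : vect_str proj V, vo_lmod (vb_vs S) = L.
Proof.
suff T n (U : domain R n) (P : U -> X) (pP : is_plot (dfl X) P) :
    exists C : domain R n -> Prop,
    [/\ forall W, C W -> forall x, W x -> U x,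
        forall x, U x -> exists2 W, C W & W x &
        forall W, C W -> trivial_over V charted_vs_over P W].
  by exists (VectStr T).
exists (fun W : domain R n => exists (WU : forall y, W y -> U y) psi,
  @linear_chart (@restr_plot _ _ (Plot pP) W WU) psi); split.
- by move=> W [WU _].
- move=> x Ux; have [W [WU [psi [Wx H]]]] := @L_charted (Plot pP) (exist _ x Ux).
  by exists W => //; exists WU, psi.
- by move=> W [WU [psi]]; exact: charted_trivial.
Qed.

(** The covering family consists of all the plots that carry a linear chart, and
comparing the charts along a 1-simplex yields the transition maps. *)
Lemma charted_gauge : exists B : gauge_str V proj,
  forall (P : member (gs_fam B)) r,
    lin_frame L (P r) (fun t : V => gs_psi B P (r, t)).
Proof.
have SL (P : plot X) (r : pl_dom P) :
    exists (W : domain R (pl_dim P)) (WU : forall y, W y -> pl_dom P y),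
      W (sval r) /\ exists psi, @linear_chart (restr_plot WU) psi.
  have [W [WU [psi [Wr H]]]] := L_charted r.
  by exists W, WU; split => //; exists psi.
pose C := local_family (S := fun P => exists psi, @linear_chart P psi) SL.
have /dependent_choice_fun[psi psiP] (P : member C) :
  exists psi, @linear_chart P psi := svalP P.
have /dependent_choice_fun[g gP] (s : simplex1 C) :
    exists g : pl_dom (s1_Q s) -> GL V,
      @smooth R (dom_space (pl_dom (s1_Q s))) (GL V) g /\
      forall r t, psi (s1_P1 s) (s1_F0 s r, t) =
                  psi (s1_P0 s) (s1_F1 s r, gl_act (g r) t).
  have [c0 l0] := linear_chart_pull (s1_F1 s) (psiP (s1_P0 s)).
  have [c1 l1] := linear_chart_pull (s1_F0 s) (psiP (s1_P1 s)).
  exact: (chart_change_gl c0 c1 l0 l1).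
exists (@GaugeStr R V X E proj proj_smooth C psi
  (fun P => chart_smooth (psiP P).1) (fun P => chart_pullback (psiP P).1)
  g (fun s => (gP s).1) (fun s => (gP s).2)) => P r.
exact: (psiP P).2.
Qed.

End LocallyCharted.

(** * Gauge bundles and vector bundles on the same projection *)

Section GaugeVersusVect.
Context {R : realType} {X : diffSpace R} {V : diffVS R}.

Lemma gauge_chart (E : diffSpace R) (proj : E -> X) (B : gauge_str V proj)
  (P : member (gs_fam B)) : is_chart proj (gs_psi B P).
Proof.
exact: (pullback_chart (@gs_psi_smooth _ _ _ _ _ B P)
  (@gs_pullback _ _ _ _ _ B P)).
Qed.

Lemma gauge_trans_point (E : diffSpace R) (proj : E -> X) (B : gauge_str V proj)
    (P P' : member (gs_fam B)) (r : pl_dom P) (r' : pl_dom P') (e : P r = P' r') :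
  forall t, gs_psi B P' (r', t) =
    gs_psi B P (r, gl_act (gs_trans B (point_simplex e) point) t).
Proof. by move=> t; rewrite -(gs_transE (s := point_simplex e)). Qed.

(** Each fiber receives the structure of V through one chart chosen at each point
of X.  Any other chart over that point differs from the chosen one by the value
of a transition map at a point simplex, hence is linear as well. *)
Lemma gauge_lmod (E : diffSpace R) (proj : E -> X) (B : gauge_str V proj) :
  exists L : forall x, GRing.Lmodule R (fiber proj x),
    forall (P : member (gs_fam B)) r,
      lin_frame L (P r) (fun t : V => gs_psi B P (r, t)).
Proof.
have base x : exists (P : member (gs_fam B)) (r : pl_dom P), P r = x.
  by have [P CP [r Pr]] := cf_cover (gs_fam B) x; exists (exist _ P CP), r.
have /dependent_choice_fun[L LP] x : exists L : GRing.Lmodule R (fiber proj x),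
    exists (P : member (gs_fam B)) (r : pl_dom P)
      (piE : forall t, proj (gs_psi B P (r, t)) = x), P r = x /\
      linear ((fun t => in_fiber (piE t)) : V -> GRing.Lmodule.Pack L).
  have [P [r Pr]] := base x; have c := gauge_chart P.
  have piE t : proj (gs_psi B P (r, t)) = x by rewrite (chart_over c).
  have /choice[k kE] (e : fiber proj x) :
      exists t, gs_psi B P (r, t) = sval e.
    by apply: (chart_onto c); rewrite Pr; exact: (svalP e).
  have [||L lL] := @transport_lmod R V (fiber proj x) k (fun t => in_fiber (piE t)).
  - by move=> e; apply: sval_inj => /=; rewrite kE.
  - by move=> t; apply: (chart_inj c (r := r)); rewrite /= kE.
  - by exists L, P, r, piE.
exists L => P r; have [P0 [r0 [piE [Pr0 lL]]]] := LP (P r).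
have l0 : lin_frame L (P r) (fun t : V => gs_psi B P0 (r0, t)) by exists piE.
have := lin_frame_comp l0 (svalP (gs_trans B (point_simplex Pr0) point)).
have -> // : (fun t : V => gs_psi B P0 (r0, t)) \o
  sval (gs_trans B (point_simplex Pr0) point) =
  (fun t : V => gs_psi B P (r, t)).
by apply/funext => t; rewrite (gauge_trans_point Pr0).
Qed.

Lemma gauge_vect (E : diffSpace R) (proj : E -> X) (B : gauge_str V proj) :
  exists S : vect_str proj V, fiberwise_linear B S.
Proof.
have [L HL] := gauge_lmod B.
have LC : @locally_charted _ _ _ _ V L.
  apply: (family_locally_charted (C := gs_fam B)) => P.
  by exists (gs_psi B P); split; [exact: gauge_chart|exact: HL].
have [S SL] := charted_vect (gs_smooth B) LC.
by exists S => P r; rewrite /vo_fiber SL; exact: HL.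
Qed.

(** The inverse of a local trivialization is a chart; on the fiber over [w] it is
the inverse of the linear diffeomorphism [phi], hence linear. *)
Lemma vect_locally_charted (E : diffSpace R) (proj : E -> X)
  (S : vect_str proj V) : @locally_charted _ _ _ _ V (vo_lmod (vb_vs S)).
Proof.
move=> P r; have [C [CU Ccov Ctriv]] := vb_trivial S (pl_plot P).
have [W CW Wr] := Ccov _ (svalP r); have WU := CU _ CW.
have [Phi [PhiE Phil]] := Ctriv _ CW.
pose q (z : prod_space (dom_space W) V) := diffeo_inv Phi z.
have qE w t : (sval (sval (q (w, t)))).1 = restr WU w.
  by apply: sval_inj; rewrite -PhiE diffeoVK.
pose psi (z : prod_space (dom_space W) V) : E := (sval (sval (q z))).2.
have psi_over w t : proj (psi (w, t)) = P (restr WU w).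
  by rewrite /psi -(svalP (sval (q (w, t)))) qE.
exists W, WU, psi; split => //; split; first split => //.
- by move=> n U G pG; have [] := diffeo_inv_smooth Phi pG.
- move=> w t t' tt'; suff : (w, t) = (w, t') by case.
  apply: (can_inj (@diffeoVK _ _ _ Phi)).
  apply: sval_inj; apply: sval_inj; rewrite -/(q _) -/(q (w, t')).
  rewrite [LHS]surjective_pairing [RHS]surjective_pairing !qE.
  by congr pair.
- move=> n U F p sF pp pE.
  have h u : P (restr WU (F u)) = proj (p u) by rewrite pE.
  pose q' u : pullback_over proj P W :=
    exist _ (exist _ (restr WU (F u), p u) (h u)) (svalP (F u)).
  exists (fun u => (Phi (q' u)).2).
    have pq' : is_plot (dfl (pullback_over proj P W)) q'.
      by split => //; exact: (smooth_dom_comp (smooth_dom_restr WU) sF).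
    by have [] := diffeo_smooth Phi pq'.
  move=> u; have <- : (Phi (q' u)).1 = F u by apply: sval_inj; rewrite PhiE.
  by rewrite /psi /q -surjective_pairing diffeoK.
- move=> w; exists (psi_over w) => a t t'.
  have [phi lphi phiE] := Phil (restr WU w) (svalP w).
  have phiK s : phi (in_fiber (psi_over w s)) = s.
    by rewrite -(phiE (q (w, s))) // /q diffeoVK.
  apply: (can_inj (@diffeoK _ _ _ phi)).
  rewrite [LHS]phiK.
  have := lphi a (in_fiber (psi_over w t)) (in_fiber (psi_over w t')).
  by rewrite !phiK => ->.
Qed.

Lemma vect_gauge (E : diffSpace R) (proj : E -> X) (S : vect_str proj V) :
  exists B : gauge_str V proj, fiberwise_linear B S.
Proof.
have [B Bl] := charted_gauge (vo_smooth S) (vect_locally_charted S).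
by exists B.
Qed.

End GaugeVersusVect.

(** * Isomorphisms of gauge bundles and of vector bundles *)

Section Isomorphisms.
Context {R : realType} {X : diffSpace R} {V : diffVS R}.

Section FiberMaps.
Context {E E' : diffSpace R} {proj : E -> X} {proj' : E' -> X}.
Variables (L : forall x, GRing.Lmodule R (fiber proj x)).
Variables (L' : forall x, GRing.Lmodule R (fiber proj' x)).
Variables (f : E -> E') (fE : forall e, proj' (f e) = proj e).

Definition fiber_map x (e : fiber proj x) : fiber proj' x :=
  in_fiber (etrans (fE (sval e)) (svalP e)).

Lemma fiber_map_linear x (u : V -> E) :
  (forall e, proj e = x -> exists t, u t = e) ->
  lin_frame L x u -> lin_frame L' x (f \o u) ->
  linear (@fiber_map x : fiber_lmod L x -> fiber_lmod L' x).
Proof.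
move=> onto lu lfu a e e'.
have h t := lin_frame_over t lu; have h' t := lin_frame_over t lfu.
have [t te] := onto _ (svalP e); have [t' te'] := onto _ (svalP e').
have -> : e = in_fiber (h t) by apply: sval_inj.
have -> : e' = in_fiber (h t') by apply: sval_inj.
have mE s : fiber_map (in_fiber (h s)) = in_fiber (h' s) by apply: sval_inj.
apply: sval_inj; rewrite !mE (lin_frameP _ _ _ lfu).
by rewrite /= (lin_frameP _ _ _ lu).
Qed.

Lemma lin_frame_fiber_map x (u : V -> E) :
  linear (@fiber_map x : fiber_lmod L x -> fiber_lmod L' x) ->
  lin_frame L x u -> lin_frame L' x (f \o u).
Proof.
move=> lf [piE lu]; exists (fun t => etrans (fE (u t)) (piE t)) => a t t'.
have mE s : fiber_map (in_fiber (piE s)) = in_fiber (etrans (fE (u s)) (piE s)).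
  by apply: sval_inj.
by have := lf a (in_fiber (piE t)) (in_fiber (piE t')); rewrite -lu !mE.
Qed.

End FiberMaps.

(** In charts over a common refinement, [Phi] is a smooth family in GL(V) as soon
as it is linear on fibers, because composing it with charts of E gives linear
charts of E', which are compared with those of E'. *)
Lemma gauge_vect_iso (E E' : diffSpace R) (proj : E -> X) (proj' : E' -> X)
    (B : gauge_str V proj) (B' : gauge_str V proj') (S : vect_str proj V)
    (S' : vect_str proj' V) (Phi : diffeo E E') :
  fiberwise_linear B S -> fiberwise_linear B' S' ->
  is_gauge_iso B B' Phi <-> is_vect_iso S S' Phi.
Proof.
move=> BS BS'; split.
  move=> [PhiE [D [f [f' H]]]]; exists PhiE => x.
  have [P DP [r <-]] := cf_cover D x.
  have [h [_ hE]] := H (exist _ P DP); move: hE.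
  set fr := ref_hom f _; set f'r := ref_hom f' _ => hE.
  have c := gauge_chart (ref_idx f (exist _ P DP)).
  have frE : ref_idx f (exist _ P DP) (fr r) = P r by rewrite homE.
  have f'rE : ref_idx f' (exist _ P DP) (f'r r) = P r by rewrite homE.
  have lu : lin_frame (vo_lmod (vb_vs S)) (P r)
      (fun t : V => gs_psi B _ (fr r, t)).
    by rewrite -[in X in lin_frame _ X]frE; exact: BS.
  have lu' : lin_frame (vo_lmod (vb_vs S')) (P r)
      (fun t : V => gs_psi B' _ (f'r r, t)).
    by rewrite -[in X in lin_frame _ X]f'rE; exact: BS'.
  apply: (fiber_map_linear PhiE _ lu).
    by move=> e er; apply: (chart_onto c); rewrite er frE.
  have := lin_frame_comp lu' (svalP (h r)).
  by congr lin_frame; apply/funext => t; rewrite /= hE.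
move=> [PhiE Phil]; split => //.
have [D [f [f' _]]] := common_refinement (gs_fam B) (gs_fam B').
exists D, f, f' => P.
have c := chart_push PhiE (chart_pull (ref_hom f P) (gauge_chart (ref_idx f P))).
have c' := chart_pull (ref_hom f' P) (gauge_chart (ref_idx f' P)).
have l r : lin_frame (vo_lmod (vb_vs S')) (P r)
    (fun t : V => Phi (gs_psi B _ (ref_hom f P r, t))).
  apply: (lin_frame_fiber_map (Phil (P r))).
  by rewrite -(homE (ref_hom f P)); exact: BS.
have l' r : lin_frame (vo_lmod (vb_vs S')) (P r)
    (fun t : V => gs_psi B' _ (ref_hom f' P r, t)).
  by rewrite -(homE (ref_hom f' P)); exact: BS'.
exact: (chart_change_gl c' c l' l).
Qed.

Definition diffeo_sym (E E' : diffSpace R) (f : diffeo E E') : diffeo E' E :=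
  Diffeo (@diffeo_inv_smooth _ _ _ f) (@diffeo_smooth _ _ _ f)
    (@diffeoVK _ _ _ f) (@diffeoK _ _ _ f).

Lemma vect_iso_refl (E : diffSpace R) (proj : E -> X) (S : vect_str proj V) :
  is_vect_iso S S (diffeo_id E).
Proof.
exists (fun e => erefl) => x.
rewrite (_ : (fun e : fiber proj x => _) = id) //.
by apply/funext => e; apply: sval_inj.
Qed.

Lemma vect_iso_sym (S S' : vect_bundle V X) : vect_iso S S' -> vect_iso S' S.
Proof.
case: S S' => [E proj S] [E' proj' S'] [Phi /= [PhiE Phil]].
have PhiE' e : proj (diffeo_sym Phi e) = proj' e.
  by rewrite -PhiE /= diffeoVK.
exists (diffeo_sym Phi); exists PhiE' => x a e e' /=.
have fK : cancel (@fiber_map _ _ _ _ _ PhiE x) (@fiber_map _ _ _ _ _ PhiE' x).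
  by move=> z; apply: sval_inj => /=; rewrite diffeoK.
have fVK : cancel (@fiber_map _ _ _ _ _ PhiE' x) (@fiber_map _ _ _ _ _ PhiE x).
  by move=> z; apply: sval_inj => /=; rewrite diffeoVK.
apply: (can_inj fK); rewrite [LHS]fVK.
have H := Phil x a (fiber_map PhiE' e) (fiber_map PhiE' e').
apply/esym; apply: (etrans H).
by congr (+%R); [congr ( *:%R)|]; exact: fVK.
Qed.

Lemma vect_iso_trans (S' S S'' : vect_bundle V X) :
  vect_iso S S' -> vect_iso S' S'' -> vect_iso S S''.
Proof.
case: S S' S'' => [E p S] [E' p' S'] [E'' p'' S''] [f /= [fE fl]] [g /= [gE gl]].
exists (diffeo_comp g f), (fun e => etrans (gE (f e)) (fE e)) => x a e e'.
have H := gl x a (fiber_map fE e) (fiber_map fE e').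
have compE z :
    in_fiber (etrans (etrans (gE (f (sval z))) (fE (sval z))) (svalP z)) =
    fiber_map gE (fiber_map fE z) :> fiber p'' x by apply: sval_inj.
rewrite !compE; apply: etrans H; congr (fiber_map _ _).
exact: fl.
Qed.

Inductive same_bundle : gauge_bundle V X -> vect_bundle V X -> Prop :=
  SameBundle (E : diffSpace R) (proj : E -> X) (B : gauge_str V proj)
    (S : vect_str proj V) of fiberwise_linear B S :
    same_bundle (GaugeBundle B) (VectBundle S).

Lemma same_bundle_iso B S B' S' : same_bundle B S -> same_bundle B' S' ->
  gauge_iso B B' <-> vect_iso S S'.
Proof.
case=> [E p {}B {}S BS] [E' p' {}B' {}S' BS'].
by split=> -[Phi H]; exists Phi; apply/(gauge_vect_iso Phi BS BS').
Qed.

Lemma same_bundle_vect B : exists S, same_bundle B S.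
Proof.
by case: B => E p B; have [S BS] := gauge_vect B; exists (VectBundle S).
Qed.

Lemma same_bundle_gauge S : exists B, same_bundle B S.
Proof.
by case: S => E p S; have [B BS] := vect_gauge S; exists (GaugeBundle B).
Qed.

End Isomorphisms.

(** * Values of a cocycle at pairs of points *)

Section CocycleValues.
Context {R : realType} {X : diffSpace R} {V : diffVS R}.
Context {C : covering_family X}.
Variable g : cocycle V C.

Definition hom_id (P : plot X) : plot_hom P P :=
  @PlotHom _ _ P P id (smooth_dom_id _) (fun _ => erefl).

(** Let the third chart of a 2-simplex be the second one, with the identity
simplex between them.  The cocycle condition then reads
g(Q, r) g(id) = g(Q', r') whenever (Q, r) and (Q', r') have the same pair of
images.  For Q' = Q and r' = r it gives g(id) = 1, and what remains is the
equality sought. *)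
Lemma cocycle_pointwise (P0 P1 : member C) (Q Q' : plot X)
    (F1 : plot_hom Q P0) (F0 : plot_hom Q P1)
    (F1' : plot_hom Q' P0) (F0' : plot_hom Q' P1) (r : pl_dom Q) (r' : pl_dom Q') :
  F1 r = F1' r' -> F0 r = F0' r' ->
  g (Simplex1 F1 F0) r = g (Simplex1 F1' F0') r'.
Proof.
have degenerate (Q1 : plot X) (G1 : plot_hom Q1 P0) (G0 : plot_hom Q1 P1)
    (r1 : pl_dom Q1) : G1 r1 = F1 r -> G0 r1 = F0 r ->
    gl_mul (g (Simplex1 F1 F0) r)
           (g (Simplex1 (hom_id P1) (hom_id P1)) (F0 r)) =
    g (Simplex1 G1 G0) r1.
  move=> e1 e0.
  have eQ : Q1 r1 = Q r by rewrite -(homE G1) e1 homE.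
  have eP : P1 (F0 r) = Q r by rewrite homE.
  pose t : simplex2 C := @Simplex2 R X C P0 P1 P1 P1 Q1 Q F1 F0 G1 G0
    (hom_id P1) (hom_id P1) (point_plot (Q r))
    (cst_hom eP) (cst_hom eQ) (cst_hom (erefl (Q r)))
    (fun _ => esym e1) (fun _ => erefl) (fun _ => e0).
  exact: (cocE g (t := t) point).
move=> e1 e0; rewrite -(degenerate _ F1' F0' r') //.
have := degenerate _ F1 F0 r erefl erefl.
by rewrite -[X in _ = X]gl_mul1 => /gl_mul_inj ->; rewrite gl_mul1.
Qed.

(** The linear map that relates the fiber coordinates at two chart points over the
same point of X. *)
Definition coc_at (P P' : member C) (r : pl_dom P) (r' : pl_dom P')
    (e : P r = P' r') : GL V := g (point_simplex e) point.

Lemma coc_atE (s : simplex1 C) r (e : s1_P0 s (s1_F1 s r) = s1_P1 s (s1_F0 s r)) :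
  g s r = coc_at e.
Proof. by case: s r e => P0 P1 Q F1 F0 r e; exact: cocycle_pointwise. Qed.

Lemma coc_at_mul (P P' P'' : member C) (r : pl_dom P) (r' : pl_dom P')
    (r'' : pl_dom P'') (e : P r = P' r') (e' : P' r' = P'' r'')
    (e'' : P r = P'' r'') :
  gl_mul (coc_at e) (coc_at e') = coc_at e''.
Proof.
pose t : simplex2 C := @Simplex2 R X C P P' P'' _ _ _
  (cst_hom e) (cst_hom (erefl (P' r')))
  (cst_hom e'') (cst_hom (erefl (P'' r'')))
  (cst_hom e') (cst_hom (erefl (P'' r'')))
  (point_plot (P'' r''))
  (hom_id _) (hom_id _) (@cst_hom _ _ (point_plot (P' r')) point _ e')
  (fun _ => erefl) (fun _ => erefl) (fun _ => erefl).
exact: (cocE g (t := t) point).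
Qed.

Lemma coc_at_comp (P P' P'' : member C) (r : pl_dom P) (r' : pl_dom P')
    (r'' : pl_dom P'') (e : P r = P' r') (e' : P' r' = P'' r'')
    (e'' : P r = P'' r'') t :
  gl_act (coc_at e) (gl_act (coc_at e') t) = gl_act (coc_at e'') t.
Proof. by rewrite -(coc_at_mul e e' e''). Qed.

Lemma coc_at_id (P : member C) (r : pl_dom P) (e : P r = P r) t :
  gl_act (coc_at e) t = t.
Proof.
apply: (can_inj (@diffeoK _ _ _ (gl_act (coc_at e)))).
by rewrite (coc_at_comp e e e).
Qed.

Lemma coc_at_smooth (P P' : member C) n (W : domain R n) (F : W -> pl_dom P)
    (F' : W -> pl_dom P') (e : forall w, P (F w) = P' (F' w)) :
  smooth_dom F -> smooth_dom F' ->
  @smooth R (dom_space W) (GL V) (fun w => coc_at (e w)).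
Proof.
move=> sF sF'; pose Q := Plot (plot_comp (pl_plot P') sF').
pose s : simplex1 C := Simplex1 (@PlotHom _ _ Q P F sF e)
  (@PlotHom _ _ Q P' F' sF' (fun _ => erefl)).
rewrite (_ : (fun w => coc_at (e w)) = (fun w : W => g s w)).
  exact: (@coc_smooth _ _ _ _ g s).
by apply/funext => w; symmetry; exact: coc_atE.
Qed.

End CocycleValues.

(** * The bundle of a cocycle *)

(** Once a chart point [bR x] is fixed over each [x], every class of the quotient
of the disjoint union of the dom(P) x V by the cocycle has a unique
representative at such a point.  The total space is thus X * V as a set; the
cocycle enters the charts [cb_psi], and a parametrization is a plot when it is
locally a chart applied to smooth coordinates. *)
Section BundleOfCocycle.
Context {R : realType} {X : diffSpace R} {V : diffVS R}.
Context {C : covering_family X}.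
Variable g : cocycle V C.

Variables (bP : X -> member C) (bR : forall x, pl_dom (bP x)).
Hypothesis bE : forall x, bP x (bR x) = x.

Definition cb_psi (P : member C) (z : pl_dom P * V) : X * V :=
  (P z.1, gl_act (coc_at g (bE (P z.1))) z.2).

(** The base chart point may be taken over any [x] known to equal [P r]. *)
Lemma cb_psiE (P : member C) (r : pl_dom P) t x (e : bP x (bR x) = P r) :
  x = P r -> cb_psi (r, t) = (x, gl_act (coc_at g e) t).
Proof. by move=> ex; subst x; rewrite (Prop_irrelevance e (bE _)). Qed.

Lemma cb_coordE (P P' : member C) (r : pl_dom P) (r' : pl_dom P') (z : X * V) t
    (e : P r = bP z.1 (bR z.1)) (e' : P r = P' r') :
  z = cb_psi (r', t) -> gl_act (coc_at g e) z.2 = gl_act (coc_at g e') t.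
Proof.
by move=> zE; subst z; exact: coc_at_comp.
Qed.

Definition cb_plot n (U : domain R n) (p : U -> X * V) : Prop :=
  forall u : U, exists (W : domain R n) (WU : forall y, W y -> U y)
    (P : member C) (F : W -> pl_dom P) (v : W -> V),
    [/\ W (sval u), smooth_dom F, is_plot (dfl V) v &
        forall w, p (restr WU w) = cb_psi (F w, v w)].

Lemma cb_plot_cover (z : X * V) : exists n (U : domain R n) (p : U -> X * V),
  cb_plot p /\ exists r, p r = z.
Proof.
exists 0%N, (full_domain 0), (fun=> z); split; last by exists point.
move=> u; exists (full_domain 0), (fun _ => id), (bP z.1), (fun=> bR z.1),
  (fun=> z.2); split => //.
- exact: smooth_dom_cst.
- exact: plot_cst.
move=> _; rewrite (cb_psiE _ (erefl _) (esym (bE z.1))) coc_at_id.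
exact: surjective_pairing.
Qed.

Lemma cb_plot_comp n m (U : domain R n) (U' : domain R m) (p : U' -> X * V)
  (F : U -> U') : cb_plot p -> smooth_dom F -> cb_plot (p \o F).
Proof.
move=> pp sF u; have [W [WU' [P [G [v [Wu sG pv pE]]]]]] := pp (F u).
have [W0 [W0U W0E]] := open_preimage W sF.
pose F0 (w : W0) : W := exist _ (sval (F (restr W0U w)))
  ((W0E (restr W0U w)).1 (svalP w)).
have sF0 : smooth_dom F0 := smooth_dom_comp sF (smooth_dom_restr W0U).
exists W0, W0U, P, (G \o F0), (v \o F0); split.
- exact/W0E.
- exact: smooth_dom_comp.
- exact: plot_comp.
- by move=> w; rewrite /= -pE; congr (p _); apply: sval_inj.
Qed.

Lemma cb_plot_sup n (A : nparams R (X * V) n) (U : domain R n) (S : U -> X * V) :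
  (forall (W : domain R n) (p : W -> X * V), A W p -> cb_plot p) ->
  is_supremum A S -> cb_plot S.
Proof.
move=> pA [_ AU AS] u; have [U' [q [Aq U'u]]] := (AU _).1 (svalP u).
have [W [WU' [P [F [v [Wu sF pv qE]]]]]] := pA _ _ Aq (exist _ _ U'u).
have WU y (Wy : W y) : U y.
  by apply/AU; exists U', q; split; [|exact: (WU' _ Wy)].
exists W, WU, P, F, v; split => // w.
by rewrite -qE; exact: (AS _ _ Aq).
Qed.

Definition cb_space : diffSpace R :=
  DiffSpace (Diffeology cb_plot_cover cb_plot_comp cb_plot_sup).

Lemma cb_proj_smooth : @smooth R cb_space X fst.
Proof.
move=> n U p pp; apply: plot_local => u.
have [W [WU [P [F [v [Wu sF pv pE]]]]]] := pp u.
exists W, WU; split => //.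
have -> : (fun y : W => (fst \o p) (exist _ (sval y) (WU _ (svalP y)))) = P \o F.
  by apply/funext => w /=; rewrite -/(restr WU w) pE.
exact: (plot_comp (pl_plot P)).
Qed.

(** A plot over P is locally read in another chart P'; its coordinate in P is then
the value of the cocycle at (P, P'), a smooth family in GL(V), applied to its
coordinate in P'. *)
Lemma cb_chart (P : member C) :
  @is_chart R cb_space X fst V P (@cb_psi P).
Proof.
split=> //.
- move=> n U G [G1 G2] u; exists U, (fun _ => id), P, (fst \o G), (snd \o G).
  split => //; first exact: svalP.
  move=> w /=; have -> : restr (fun _ => id) w = w by apply: sval_inj.
  by case: (G w).
- by move=> r t t' /= [] /(can_inj (@diffeoK _ _ _ (gl_act _))).
move=> n U F p sF pp pE.
have e u : P (F u) = bP (p u).1 (bR (p u).1) by rewrite bE -pE.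
exists (fun u => gl_act (coc_at g (e u)) (p u).2); last first.
  move=> u; rewrite (cb_psiE _ (esym (e u)) (pE u)) (coc_at_comp _ _ _ erefl).
  by rewrite coc_at_id -surjective_pairing.
apply: plot_local => u.
have [W [WU [P' [F' [v [Wu sF' pv qE]]]]]] := pp u.
exists W, WU; split => //.
have e' w : P (F (restr WU w)) = P' (F' w) by rewrite -pE qE.
have -> : (fun y : W => gl_act (coc_at g (e (exist _ (sval y) (WU _ (svalP y)))))
   (p (exist _ (sval y) (WU _ (svalP y)))).2) =
  (fun w => gl_act (coc_at g (e' w)) (v w)).
  by apply/funext => w; exact: cb_coordE (qE w).
have sFW := smooth_dom_comp sF (smooth_dom_restr WU).
have [sc _] := gl_smooth (coc_at_smooth (F := F \o restr WU) g e' sFW sF').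
exact: (ev_smooth_plot sc (smooth_dom_id W) pv).
Qed.

Lemma cb_trans (s : simplex1 C) (r : pl_dom (s1_Q s)) (t : V) :
  cb_psi (s1_F0 s r, t) = cb_psi (s1_F1 s r, gl_act (g s r) t).
Proof.
have e : s1_P0 s (s1_F1 s r) = s1_P1 s (s1_F0 s r) by rewrite !homE.
rewrite (cb_psiE _ (etrans (bE _) e) e) (coc_atE g e) /cb_psi /=.
by rewrite (coc_at_comp _ _ _ (etrans (bE _) e)).
Qed.

Definition cb_gauge : @gauge_str R V X cb_space fst :=
  GaugeStr cb_proj_smooth (fun P => chart_smooth (cb_chart P))
    (fun P => chart_pullback (cb_chart P)) (@coc_smooth _ _ _ _ g) cb_trans.

End BundleOfCocycle.

(** * Cech classes *)

Section CechClasses.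
Context {R : realType} {X : diffSpace R} {V : diffVS R}.


Lemma gauge_cocycle (B : gauge_bundle V X) :
  exists g : cocycle V (gs_fam (gb_str B)),
    forall s, g s =1 gs_trans (gb_str B) s.
Proof.
case: B => E proj B /=.
have coc (t : simplex2 (gs_fam B)) (r : pl_dom (s2_Q t)) :
    gl_mul (gs_trans B (s2_face2 t) (s2_F2 t r))
           (gs_trans B (s2_face0 t) (s2_F0 t r))
    = gs_trans B (s2_face1 t) (s2_F1 t r).
  apply: gl_ext => v.
  apply: (chart_inj (gauge_chart (s2_P0 t)) (r := s2_F21 t (s2_F2 t r))) => /=.
  rewrite -(gs_transE (s := s2_face2 t)) /= [in LHS]s2_E1.
  rewrite -(gs_transE (s := s2_face0 t)) /= -[in LHS]s2_E2.
  by rewrite (gs_transE (s := s2_face1 t)) /= [in RHS]s2_E0.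
by exists (Cocycle (@gs_trans_smooth _ _ _ _ _ B) coc).
Qed.

Section Equivalence.
Variable C : covering_family X.

Lemma coc_equiv_refl (g : cocycle V C) : coc_equiv g g.
Proof.
exists (fun _ _ => gl_one); split=> [P|s r]; first exact: gl_one_smooth.
exact: gl_ext.
Qed.

Lemma coc_equiv_sym (g g' : cocycle V C) : coc_equiv g g' -> coc_equiv g' g.
Proof.
move=> [h [sh hE]]; exists (fun P r => gl_inv (h P r)); split.
  by move=> P; exact: gl_inv_smooth.
move=> s r; apply: gl_ext => t /=.
apply: (can_inj (@diffeoK _ _ _ (gl_act (h _ (s1_F1 s r))))); rewrite /= diffeoVK.
have := congr1 (fun a => gl_act a (diffeo_inv (gl_act (h _ (s1_F0 s r))) t))
  (hE s r).
by rewrite /= diffeoVK.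
Qed.

Lemma coc_equiv_trans (g' g g'' : cocycle V C) :
  coc_equiv g g' -> coc_equiv g' g'' -> coc_equiv g g''.
Proof.
move=> [h [sh hE]] [h' [sh' hE']].
exists (fun P r => gl_mul (h' P r) (h P r)); split.
  by move=> P; exact: gl_mul_smooth.
move=> s r; apply: gl_ext => t /=.
have /= -> := congr1 (fun a => gl_act a (gl_act (h _ (s1_F0 s r)) t)) (hE' s r).
congr (gl_act _ _).
exact: (congr1 (fun a => gl_act a t) (hE s r)).
Qed.

End Equivalence.

Lemma ref_cocycle_equiv (C D : covering_family X) (f : refinement C D)
    (g g' : cocycle V C) :
  coc_equiv g g' -> coc_equiv (ref_cocycle f g) (ref_cocycle f g').
Proof.
move=> [h [sh hE]]; exists (fun P r => h (ref_idx f P) (ref_hom f P r)); split.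
  move=> P n U F sF; apply: sh.
  exact: (smooth_dom_comp (hom_smooth (ref_hom f P)) sF).
by move=> s r; exact: (hE (ref_simplex1 f s) r).
Qed.

(** The representative chosen by [H1_map] is equivalent to [g], and refinement
preserves equivalence. *)
Lemma H1_map_class (C D : covering_family X) (f : refinement C D)
  (g : cocycle V C) : H1_map f (qclass _ g) = qclass _ (ref_cocycle f g).
Proof.
rewrite /H1_map; case: cid => g' /= gg'.
apply: qclass_eq; [exact: coc_equiv_sym|exact: coc_equiv_trans|].
apply: ref_cocycle_equiv; apply: coc_equiv_sym.
by rewrite gg'; exact: coc_equiv_refl.
Qed.

Lemma cech_relE (C C' : covering_family X) (g : cocycle V C) (g' : cocycle V C') :
  cech_rel (existT _ C (qclass (@coc_equiv _ _ _ C) g))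
           (existT _ C' (qclass (@coc_equiv _ _ _ C') g')) <->
  exists (D : covering_family X) (f : refinement C D) (f' : refinement C' D),
    coc_equiv (ref_cocycle f g) (ref_cocycle f' g').
Proof.
split=> -[D [f [f' H]]]; exists D, f, f'.
  move: H; rewrite !H1_map_class; apply: qclass_eqr; exact: coc_equiv_refl.
rewrite !H1_map_class; apply: qclass_eq => //.
- exact: coc_equiv_sym.
- exact: coc_equiv_trans.
Qed.

End CechClasses.

(** * Equivalent cocycles and isomorphic bundles *)

Section Gluing.
Context {R : realType} {X : diffSpace R} {V : diffVS R}.

(** A space over X with charts over a covering family is the colimit of these
charts: a plot of E is locally a chart applied to smooth coordinates. *)
Lemma glue_charts (E Y : diffSpace R) (proj : E -> X) (D : covering_family X)
    (psi : forall P : member D, prod_space (dom_space (pl_dom P)) V -> E)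
    (q : forall P : member D, prod_space (dom_space (pl_dom P)) V -> Y) :
  smooth proj -> (forall P, is_chart proj (psi P)) -> (forall P, smooth (q P)) ->
  (forall P P' z z', psi P z = psi P' z' -> q P z = q P' z') ->
  exists Phi : E -> Y, smooth Phi /\ forall P z, Phi (psi P z) = q P z.
Proof.
move=> sproj c sq qE.
have /choice[Phi PhiE] e : exists y, exists (P : member D) z,
    psi P z = e /\ q P z = y.
  have [P DP [r Pr]] := cf_cover D (proj e).
  have [t et] := chart_onto (c (exist _ P DP)) (esym Pr).
  by exists (q (exist _ P DP) (r, t)), (exist _ P DP), (r, t).
have PhiP (P : member D) z : Phi (psi P z) = q P z.
  by have [P' [z' [/qE <- ->]]] := PhiE (psi P z).
exists Phi; split => // n U p pp; apply: plot_local => u.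
have [W [WU [P [f Wu]]]] := @cf_local _ _ D (Plot (sproj _ _ _ pp)) u.
exists W, WU; split => //.
have [|v pv vE] := chart_lift (c P) (hom_smooth f)
    (plot_comp pp (smooth_dom_restr WU)).
  by move=> w; rewrite homE.
have -> : (fun y : W => (Phi \o p) (exist _ (sval y) (WU _ (svalP y)))) =
          (fun w => q P (f w, v w)).
  by apply/funext => w; rewrite -PhiP vE.
exact: (sq P _ _ _ (conj (hom_smooth f) pv :
  is_plot (dfl (prod_space (dom_space (pl_dom P)) V)) (fun w => (f w, v w)))).
Qed.

Section CocycleIso.
Context {E E' : diffSpace R} {proj : E -> X} {proj' : E' -> X}.
Context {B : gauge_str V proj} {B' : gauge_str V proj'}.
Variables (g : cocycle V (gs_fam B)) (g' : cocycle V (gs_fam B')).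
Hypotheses (gE : forall s, g s =1 gs_trans B s).
Hypotheses (gE' : forall s, g' s =1 gs_trans B' s).

(** The charts of B, and those of B' twisted by the equivalence [h], identify the
same pairs of points: by the relation between [h], [g] and [g'] at a point
simplex, both families have the transition map g.  Gluing in both directions
gives a diffeomorphism and its inverse. *)
Lemma coc_equiv_iso (D : covering_family X) (f : refinement (gs_fam B) D)
    (f' : refinement (gs_fam B') D) :
  coc_equiv (ref_cocycle f g) (ref_cocycle f' g') ->
  exists Phi, is_gauge_iso B B' Phi.
Proof.
move=> [h [sh hE]].
pose psi (P : member D) (z : prod_space (dom_space (pl_dom P)) V) : E :=
  gs_psi B (ref_idx f P) (ref_hom f P z.1, z.2).
pose psi' (P : member D) (z : prod_space (dom_space (pl_dom P)) V) : E' :=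
  gs_psi B' (ref_idx f' P) (ref_hom f' P z.1, z.2).
pose q (P : member D) (z : prod_space (dom_space (pl_dom P)) V) :=
  psi' P (z.1, gl_act (h P z.1) z.2).
have c (P : member D) : is_chart proj (psi P) :=
  chart_pull (ref_hom f P) (gauge_chart _).
have c' (P : member D) : is_chart proj' (psi' P) :=
  chart_pull (ref_hom f' P) (gauge_chart _).
have cq (P : member D) : is_chart proj' (q P) := chart_twist (sh P) (c' P).
have key (P P' : member D) z z' : psi P z = psi P' z' <-> q P z = q P' z'.
  case: z z' => [r t] [r' t'].
  suff main : P r = P' r' -> psi P (r, t) = psi P' (r', t') <->
                             q P (r, t) = q P' (r', t').
    split=> H; apply/main => //.
      by rewrite -(chart_over (c P) r t) H (chart_over (c P')).
    by rewrite -(chart_over (cq P) r t) H (chart_over (cq P')).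
  move=> e; pose s : simplex1 D := point_simplex e.
  pose a := gl_act (gs_trans B (ref_simplex1 f s) point).
  pose a' := gl_act (gs_trans B' (ref_simplex1 f' s) point).
  have aE t1 : psi P' (r', t1) = psi P (r, a t1).
    exact: (gs_transE (s := ref_simplex1 f s) point t1).
  have a'E t1 : psi' P' (r', t1) = psi' P (r, a' t1).
    exact: (gs_transE (s := ref_simplex1 f' s) point t1).
  have aa' t1 : a' (gl_act (h P' r') t1) = gl_act (h P r) (a t1).
    have /= := congr1 (fun k => gl_act k t1) (hE s point).
    by rewrite gE gE'.
  have qaE : q P' (r', t') = q P (r, a t').
    by rewrite /q /= a'E aa'.
  rewrite aE qaE; split => [/(chart_inj (c P)) -> //|].
  by move=> /(chart_inj (cq P)) ->.
have [Phi [sPhi PhiE]] := glue_charts (gs_smooth B) c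
  (fun P => chart_smooth (cq P)) (fun P P' z z' => (key P P' z z').1).
have [Psi [sPsi PsiE]] := glue_charts (gs_smooth B') cq
  (fun P => chart_smooth (c P)) (fun P P' z z' => (key P P' z z').2).
have onto (Y : diffSpace R) (p : Y -> X) (k : forall P : member D,
    prod_space (dom_space (pl_dom P)) V -> Y) y :
    (forall P, is_chart p (k P)) -> exists P z, k P z = y.
  move=> ck; have [P DP [r Pr]] := cf_cover D (p y).
  have [t et] := chart_onto (ck (exist _ P DP)) (esym Pr).
  by exists (exist _ P DP), (r, t).
have PhiK : cancel Phi Psi.
  by move=> e; have [P [z <-]] := onto _ _ _ e c; rewrite PhiE PsiE.
have PsiK : cancel Psi Phi.
  by move=> e; have [P [z <-]] := onto _ _ _ e cq; rewrite PsiE PhiE.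
exists (Diffeo sPhi sPsi PhiK PsiK); split => /=.
  move=> e; have [P [[r t] <-]] := onto _ _ _ e c.
  by rewrite PhiE (chart_over (cq P)) (chart_over (c P)).
exists D, f, f' => P; exists (h P); split => // r t.
exact: (PhiE P (r, t)).
Qed.

(** As charts of B' are injective on fibers, it is enough to read [Phi] along both
sides of a 1-simplex. *)
Lemma iso_coc_equiv (Phi : diffeo E E') : is_gauge_iso B B' Phi ->
  exists (D : covering_family X) (f : refinement (gs_fam B) D)
    (f' : refinement (gs_fam B') D),
    coc_equiv (ref_cocycle f g) (ref_cocycle f' g').
Proof.
move=> [PhiE [D [f [f' H]]]]; exists D, f, f'.
have /dependent_choice_fun[h hP] := H.
exists h; split=> [P|s r]; first exact: (hP P).1.
apply: gl_ext => t /=; rewrite gE gE'.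
pose s0 := ref_simplex1 f s; pose s0' := ref_simplex1 f' s.
apply: (chart_inj (gauge_chart (s1_P0 s0')) (r := s1_F1 s0' r)) => /=.
rewrite -(gs_transE (s := s0')) /= -(hP _).2 -(hP _).2.
by rewrite (gs_transE (s := s0)).
Qed.

End CocycleIso.

Inductive cocycle_of :
    {C : covering_family X & H1 V C} -> gauge_bundle V X -> Prop :=
  CocycleOf (B : gauge_bundle V X) (g : cocycle V (gs_fam (gb_str B))) of
    (forall s, g s =1 gs_trans (gb_str B) s) :
    cocycle_of (existT (fun C => H1 V C) _ (qclass (@coc_equiv R X V _) g)) B.

Lemma cocycle_of_iso a B a' B' : cocycle_of a B -> cocycle_of a' B' ->
  cech_rel a a' <-> gauge_iso B B'.
Proof.
case=> {}B g gE; case=> {}B' g' gE'; rewrite cech_relE; split.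
  by move=> [D [f [f' H]]]; exact: (coc_equiv_iso gE gE' H).
by move=> [Phi H]; exact: (iso_coc_equiv gE gE' H).
Qed.

Lemma cocycle_of_bundle a : exists B, cocycle_of a B.
Proof.
case: a => C a; have [g ->] := qclassP a.
have base x : exists P : member C, exists r : pl_dom P, P r = x.
  by have [P CP [r Pr]] := cf_cover C x; exists (exist _ P CP), r.
have /choice[bP bPE] := base; have /dependent_choice_fun[bR bE] := bPE.
exists (GaugeBundle (cb_gauge g bE)).
exact: (@CocycleOf (GaugeBundle (cb_gauge g bE)) g).
Qed.

Lemma bundle_cocycle_of B : exists a, cocycle_of a B.
Proof. by have [g gE] := gauge_cocycle B; eexists; apply: CocycleOf gE. Qed.

End Gluing.

(** * The correspondences *)

Theorem proposition6p12 (R : realType) (X : diffSpace R) (V : diffVS R) :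
  (forall (E : diffSpace R) (pi : E -> X),
     (forall B : gauge_str V pi,
        exists2 S : vect_str pi V, fiberwise_linear B S &
        forall S' : vect_str pi V, fiberwise_linear B S' ->
          is_vect_iso S S' (diffeo_id E)) /\
     (forall S : vect_str pi V,
        exists2 B : gauge_str V pi, fiberwise_linear B S &
        forall B' : gauge_str V pi, fiberwise_linear B' S ->
          is_gauge_iso B B' (diffeo_id E))) /\
  (exists2 Theta : Bund V X -> BundVect V X, bijective Theta &
     forall (E : diffSpace R) (pi : E -> X) (B : gauge_str V pi)
       (S : vect_str pi V), fiberwise_linear B S ->
       Theta (qclass _ (GaugeBundle B)) = qclass _ (VectBundle S)) /\
  (exists2 Psi : CechH1 X V -> Bund V X, bijective Psi &
     forall B : gauge_bundle V X,
       exists2 g : cocycle V (gs_fam (gb_str B)),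
         (forall s, g s =1 gs_trans (gb_str B) s) &
         Psi (cech_class g) = qclass _ B).
Proof.
have vR (S : vect_bundle V X) : vect_iso S S.
  by case: S => E p S; exists (diffeo_id E); exact: vect_iso_refl.
have vC := @vect_iso_sym R X V; have vT := @vect_iso_trans R X V.
split; last split.
- move=> E pi; split=> [B|S].
    have [S BS] := gauge_vect B; exists S => // S' BS'.
    apply/(gauge_vect_iso _ BS BS').
    exact/(gauge_vect_iso _ BS BS)/vect_iso_refl.
  have [B BS] := vect_gauge S; exists B => // B' BS'.
  exact/(gauge_vect_iso _ BS BS')/vect_iso_refl.
- have [Theta bTheta ThetaE] := quot_bij vR vC vT
    same_bundle_vect same_bundle_gauge same_bundle_iso.
  by exists Theta => // E pi B S BS; apply: ThetaE; exact: SameBundle.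
have gR (B : gauge_bundle V X) : gauge_iso B B.
  by have [S BS] := same_bundle_vect B; exact/(same_bundle_iso BS BS).
have gC (B B' : gauge_bundle V X) : gauge_iso B B' -> gauge_iso B' B.
  have [S BS] := same_bundle_vect B; have [S' BS'] := same_bundle_vect B'.
  by move=> /(same_bundle_iso BS BS')/vC/(same_bundle_iso BS' BS).
have gT (B B' B'' : gauge_bundle V X) :
    gauge_iso B' B -> gauge_iso B B'' -> gauge_iso B' B''.
  have [S BS] := same_bundle_vect B; have [S' BS'] := same_bundle_vect B'.
  have [S'' BS''] := same_bundle_vect B''.
  move=> /(same_bundle_iso BS' BS) H /(same_bundle_iso BS BS'') H'.
  exact/(same_bundle_iso BS' BS'')/(vT _ _ _ H).
have [Psi bPsi PsiE] := quot_bij gR gC gT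
  (@cocycle_of_bundle R X V) (@bundle_cocycle_of R X V) (@cocycle_of_iso R X V).
exists Psi => // B; have [g gE] := gauge_cocycle B.
by exists g => //; apply: PsiE; exact: CocycleOf.
Qed.
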